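(* Let $m\ge 2$ and let $(v_1,\dots,v_{2m})$ be a point of $\mathrm{Conf}_{2m}(m)$. For $i=1,\dots,m$ put \[\rho_i=\frac{\langle i,i+1,\dots,i+m-2,2m-1\rangle}{\langle i,i+1,\dots,i+m-2,2m\rangle}.\] Then, on the level of symbols, \[-\frac{2m-1}{m!\,(m-1)!}\,\mathrm{Gr}_m \;\overset{\mathcal S}{=}\; \mathrm{Alt}_{2m}\, I(0;0,\rho_1,\rho_2,\dots,\rho_{m-1};\rho_m).\]
   Context: Configurations: $\mathrm{Conf}_n(m)$ is the space of $n$-tuples $(v_1,\dots,v_n)$ of vectors in general position in $\mathbb C^m$ modulo the diagonal action of $\mathrm{GL}_m(\mathbb C)$; $\langle i_1,\dots,i_m\rangle=\det(v_{i_1},\dots,v_{i_m})$. For a function or symbol $f(v_1,\dots,v_n)$, $\mathrm{Alt}_n f=\sum_{\sigma\in\mathfrak S_n}\mathrm{sgn}(\sigma) f(v_{\sigma(1)},\dots,v_{\sigma(n)})$. Iterated integrals and symbols: $I(x_0;x_1,\dots,x_N;x_{N+1})$ denotes the (motivic / Hodge-theoretic version of the) iterated integral $\int_{x_0<t_1<\dots<t_N<x_{N+1}}\frac{dt_1}{t_1-x_1}\wedge\dots\wedge\frac{dt_N}{t_N-x_N}$, of weight $N$. Its symbol $\mathcal S(I)$ is an element of the $N$-fold tensor power of the multiplicative group of rational functions (in the coordinates of the $v_i$), written multiplicatively and taken modulo torsion, defined recursively by $\mathcal S(I(x_0;\,;x_1))=1$ and \[\mathcal S(I(x_0;x_1,\dots,x_N;x_{N+1}))=\sum_{i=1}^N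 \mathcal S(I(x_0;x_1,\dots,\widehat{x_i},\dots,x_N;x_{N+1}))\otimes \ell(x_{i-1},x_i,x_{i+1}),\] where $\ell(a,b,c)=\frac{b-c}{b-a}$ if $a\ne b\ne c$, $\ell(a,b,c)=\frac{1}{b-a}$ if $a\neq b=c$, $\ell(a,b,c)=b-c$ if $a=b\ne c$, $\ell(a,b,c)=1$ if $a=b=c$ (a tensor with a factor $1$ is zero). $\mathcal S$ is extended linearly. $A\overset{\mathcal S}{=}B$ means $\mathcal S(A)=\mathcal S(B)$. Grassmannian polylogarithm: $\mathrm{Gr}_m(v_1,\dots,v_{2m})$ is Goncharov's multivalued Grassmannian $m$-logarithm on $\mathrm{Conf}_{2m}(m)$, defined as $\mathrm{Alt}_{2m}F$ where $F$ is a primitive of the closed 1-form $\mathrm{Alt}_{2m}\big(\mathcal A_{m-1}(v_1,\dots,v_m;v_{m+1},\dots,v_{2m})\,d\log\langle m+1,\dots,2m\rangle\big)$ with $\mathcal A_{m-1}$ the Aomoto polylogarithm. Its symbol is (Goncharov) $\mathcal S(\mathrm{Gr}_m)=2(-1)^m(m!)^2\,\mathrm{Alt}_{2m}\,\langle 1,\dots,m\rangle\otimes\langle 2,\dots,m+1\rangle\otimes\dots\otimes\langle m,\dots,2m-1\rangle$. *)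

(* Defs.v *)
From HB Require Import structures.
From mathcomp Require Import all_boot all_fingroup all_algebra.
From mathcomp Require Import reals complex.
From mathcomp Require Import monalg.
From mathcomp Require Import mpoly.

Set Implicit Arguments.
Unset Strict Implicit.
Unset Printing Implicit Defensive.

Import GRing.Theory.
Local Open Scope ring_scope.

Definition Alt n (T : Type) (W : lmodType rat) (f : n.-tuple T -> W)
    (v : n.-tuple T) : W :=
  \sum_(s : 'S_n) (-1) ^+ s *: f [tuple tnth v (s i) | i < n].

Section Symbols.
Variable K : fieldType.

(* v is the list v_1, v_2, ... (indexed from 1) and s the list i_1, ..., i_m. *)
Definition bracket m (v : seq 'cV[K]_m) (s : seq nat) : K :=
  \det (\matrix_(i < m, j < m) (nth 0 v (nth 0%N s j).-1) i 0).

Definition nonzero : Type := {x : K | x != 0}.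
HB.instance Definition _ := Choice.on nonzero.

(* Symbols live in the tensor algebra of the Q-vector space K^* (x) Q, whose
   degree N part contains the N-fold tensor power of K^* modulo torsion.  It is
   presented as the free associative Q-algebra on the elements of K^* (the
   product of words being the tensor product), modulo the two-sided ideal
   [tensor_null] generated by the relations [x y] = [x] + [y]. *)
Definition words : Type := {malg rat[{fmonom nonzero}]}.
HB.instance Definition _ := GRing.Lalgebra.on words.

(* The default value 1 is used only for x = 0, which is not in K^*. *)
Definition letter (x : K) : words :=
  mkmalgU (fmu (insubd (exist _ 1 (oner_neq0 K) : nonzero) x)) 1.

Inductive tensor_null : words -> Prop :=
| tensor_null_rel (x y : K) : x != 0 -> y != 0 ->
    tensor_null (letter (x * y) - letter x - letter y)
| tensor_nullD (s t : words) :
    tensor_null s -> tensor_null t -> tensor_null (s + t)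
| tensor_nullM (p t q : words) : tensor_null t -> tensor_null (p * t * q).

Definition ell (a b c : K) : K :=
  if a == b then (if b == c then 1 else b - c)
  else (if b == c then (b - a)^-1 else (b - c) / (b - a)).

(* Symbol of I(x_0; x_1, ..., x_N; x_(N+1)); the sequence x \o bump i is x with
   its entry x_i deleted. *)
Fixpoint symbol_rec (N : nat) (x : nat -> K) : words :=
  if N is N'.+1 then
    \sum_(1 <= i < N.+1)
      symbol_rec N' (x \o bump i) * letter (ell (x i.-1) (x i) (x i.+1))
  else 1.

Definition symbol_I (x0 : K) (xs : seq K) (x1 : K) : words :=
  symbol_rec (size xs) (nth 0 (x0 :: rcons xs x1)).

(* Goncharov's formula for the symbol of the Grassmannian polylogarithm. *)
Definition symbol_Gr m (v : (2 * m).-tuple 'cV[K]_m) : words :=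
  (2 * (-1) ^+ m * m`!%:R ^+ 2) *:
    Alt (fun w : (2 * m).-tuple 'cV[K]_m =>
           \prod_(1 <= k < m.+1) letter (bracket w (iota k m))) v.

(* The functions Gr_m(v_1, ..., v_2m) and I(x_0; x_1, ..., x_N; x_(N+1)) are
   formal generators here, of which only the symbols matter. *)
Definition polylog m : Type := ((2 * m).-tuple 'cV[K]_m + K * seq K * K)%type.
HB.instance Definition _ m := Choice.on (polylog m).

Definition Gr m (v : (2 * m).-tuple 'cV[K]_m) : {malg rat[polylog m]} :=
  mkmalgU (inl v : polylog m) 1.

Definition II m (x0 : K) (xs : seq K) (x1 : K) : {malg rat[polylog m]} :=
  mkmalgU (inr (x0, xs, x1) : polylog m) 1.

(* The symbol of a generator and its Q-linear extension. *)
Definition symbol1 m (p : polylog m) : words :=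
  match p with
  | inl v => symbol_Gr v
  | inr (x0, xs, x1) => symbol_I x0 xs x1
  end.

Definition symbol m : {malg rat[polylog m]} -> words :=
  monalg.mmap (in_alg words) (@symbol1 m).

Definition symbol_eq m (A B : {malg rat[polylog m]}) : Prop :=
  tensor_null (symbol A - symbol B).

Definition rho m (v : (2 * m).-tuple 'cV[K]_m) (i : nat) : K :=
  bracket v (rcons (iota i m.-1) (2 * m - 1)%N)
    / bracket v (rcons (iota i m.-1) (2 * m)%N).

End Symbols.

(* Rational functions over the complex numbers in the coordinates of v_1, ...,
   v_2m; [generic] is the tuple (v_1, ..., v_2m) itself. *)
Definition ratfun (R : realType) (m : nat) : Type :=
  {fraction (mpoly (m * (2 * m)) R[i])}.
HB.instance Definition _ (R : realType) m := GRing.Field.on (ratfun R m).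

Definition generic (R : realType) (m : nat) :
    (2 * m).-tuple 'cV[ratfun R m]_m :=
  [tuple \col_(i < m)
     (tofrac ('X_(mxvec_index i j) : mpoly (m * (2 * m)) R[i]) : ratfun R m)
   | j < 2 * m].

(* Main.v *)
Require Import Defs.
From HB Require Import structures.
From mathcomp Require Import all_boot all_fingroup all_algebra.
From mathcomp Require Import reals complex.
From mathcomp Require Import monalg.
From mathcomp Require Import mpoly.
From mathcomp Require Import zify ring.

Set Implicit Arguments.
Unset Strict Implicit.
Unset Printing Implicit Defensive.

Import GRing.Theory.
Local Open Scope ring_scope.

(* In the recursion for the symbol of I(0; 0, rho_1, ..., rho_(m-1); rho_m), all
   terms deleting some rho_l with neighbours rho_(l-1), rho_(l+1) vanish after
   alternation: what remains is symmetric in (v_(l-1), v_l) and in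
   (v_(l+m-2), v_(l+m-1)), and by the Pluecker relation every bracket of the
   deleted letter is symmetric in one of these pairs.  With
   a_i = (rho_i - rho_(i+1)) / rho_i the symbol becomes
     sum_k a_(m-1) (x) ... (x) a_k (x) rho_k (x) a_(k-1) (x) ... (x) a_1.
   Write P, Q for the last two points.  Each a_i is, up to sign, the alternating
   sum over two bits b, c of the brackets on the points x < j <= y + m - 1 with
   x = i - 1 + b, y = i - 1 + c, together with P if c = 0 and Q if b = 1.
   A word is thus an m x 2m incidence matrix, whose alternation is alternating
   in the columns; the points j < m and Q depend only on the bits b, the other
   points only on the bits c.  A repeated column kills the word, so that only
   b = 1..1 0..0 1..1 0..0 with the ascent at the inserted rho_k survives, and
   then the columns are those of a staircase with two columns a < k <= c (or
   a <= k < c) removed and one column added.  The two terms of rho_k and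
   rho_(k+1) with the same added column cancel, and each of the remaining
   2m(2m-1) terms is the symbol of Gr_m up to a common factor. *)

(** * Alternating functions and signed sums *)

Section Alternating.

Variables (R : nzRingType) (W : lmodType R) (N : nat).

(** The sign rule is imposed at one total length [N] only, so that freezing some entries of an
    alternating function leaves an alternating function of the others. *)
Definition alternating T (phi : seq T -> W) := forall s1 x y s2,
  (size s1 + (size s2).+2)%N = N ->
  phi (s1 ++ x :: y :: s2) = - phi (s1 ++ y :: x :: s2).

Variables (T : Type) (phi : seq T -> W).
Hypothesis phi_alt : alternating phi.

Lemma alternating_move s1 x s2 s3 :
    size (s1 ++ x :: s2 ++ s3) = N ->
  phi (s1 ++ x :: s2 ++ s3) = (-1) ^+ size s2 *: phi (s1 ++ s2 ++ x :: s3).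
Proof.
elim: s2 s1 => [|y s2 IH] s1; first by rewrite scale1r.
rewrite !size_cat /= size_cat => szN.
rewrite phi_alt; last by rewrite size_cat; lia.
rewrite -cat_rcons IH; last by rewrite !size_cat size_rcons /= size_cat; lia.
by rewrite cat_rcons exprS mulN1r scaleNr.
Qed.

Lemma alternating_rev s1 s :
    size (s1 ++ s) = N ->
  phi (s1 ++ rev s) = (-1) ^+ 'C(size s, 2) *: phi (s1 ++ s).
Proof.
elim: s s1 => [|x s IH] s1; first by rewrite scale1r.
rewrite size_cat /= => szN; rewrite rev_cons -cats1.
have := @alternating_move s1 x (rev s) [::]; rewrite cats0 => mv.
have {mv} -> : phi (s1 ++ rev s ++ [:: x])
    = (-1) ^+ size s *: phi (rcons s1 x ++ rev s).
  rewrite cat_rcons mv; last by rewrite !size_cat /= size_rev; lia.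
  by rewrite scalerA size_rev -expr2 sqrr_sign scale1r.
rewrite IH; last by rewrite size_cat size_rcons; lia.
by rewrite cat_rcons scalerA -exprD binS bin1 addnC.
Qed.

End Alternating.

Lemma eq_opp_0 (W : lmodType rat) (x : W) : x = - x -> x = 0.
Proof.
move=> xN; have : 2%:R *: x = 0 by rewrite scaler_nat mulr2n {2}xN subrr.
by move/eqP; rewrite scaler_eq0 => /orP[|/eqP].
Qed.

(** Two equal entries are first moved next to each other; exchanging them then changes the sign but
    not the argument. *)
Lemma alternating_dup (W : lmodType rat) N (T : eqType) (phi : seq T -> W) s :
    alternating N phi ->
  size s = N -> ~~ uniq s -> phi s = 0.
Proof.
move=> phi_alt; suff dup s1 : size (s1 ++ s) = N -> ~~ uniq s -> phi (s1 ++ s) = 0.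
  exact: (dup [::]).
elim: s s1 => [//|x s IH] s1 szN.
rewrite cons_uniq negb_and negbK => /orP[/splitPr xs|s_dup]; last first.
  by rewrite -cat_rcons IH // cat_rcons.
case: xs szN => s2 s3 szN; rewrite (alternating_move phi_alt) //.
suff -> : phi (s1 ++ s2 ++ x :: x :: s3) = 0 by rewrite scaler0.
apply: eq_opp_0; rewrite catA; apply: phi_alt.
by move: szN; rewrite !size_cat /= size_cat /=; lia.
Qed.

Section SignedSum.

Variable W : lmodType rat.

Fixpoint bsum n (h : seq bool -> W) : W :=
  if n is n'.+1
  then bsum n' (h \o cons false) - bsum n' (h \o cons true) else h [::].

Lemma eq_bsum n h1 h2 :
  (forall s, size s = n -> h1 s = h2 s) -> bsum n h1 = bsum n h2.
Proof.
elim: n h1 h2 => [|n IH] h1 h2 eqh /=; first exact: eqh.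
by congr (_ - _); apply: IH => s sz; apply: eqh => /=; rewrite sz.
Qed.

Lemma bsumB n h1 h2 :
  bsum n (fun s => h1 s - h2 s) = bsum n h1 - bsum n h2.
Proof.
elim: n h1 h2 => [|n IH] h1 h2 //=.
rewrite (IH (h1 \o cons false)) (IH (h1 \o cons true)) /=.
by rewrite !opprD !opprK -!addrA; congr (_ + _); rewrite addrCA.
Qed.

(** A bit word without an ascent [false, true] is a block of [true] followed by a block of [false],
    and [bsum] weights it by the parity of the first block. *)
Lemma bsum_monotone n h :
    (forall s1 s2, size (s1 ++ [:: false, true & s2]) = n ->
       h (s1 ++ [:: false, true & s2]) = 0) ->
  bsum n h
  = \sum_(0 <= a < n.+1) (-1) ^+ a *: h (nseq a true ++ nseq (n - a) false).
Proof.
elim: n h => [|n IH] h h0 /=; first by rewrite big_nat1 scale1r.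
rewrite !IH => [|s1 s2 sz|s1 s2 sz]; first last.
- by apply: (h0 (false :: s1)) => /=; rewrite sz.
- by apply: (h0 (true :: s1)) => /=; rewrite sz.
(* A leading [false] leaves only the all-[false] tail; the words with a leading [true] give the
   terms of positive index. *)
rewrite [in LHS]big_nat_recl // big1_seq ?addr0 /=; last first.
  move=> i; rewrite mem_index_iota => /andP[_ lin].
  rewrite (h0 [::] (nseq i true ++ nseq (n - i.+1) false)) ?scaler0 //=.
  by rewrite size_cat !size_nseq; lia.
rewrite [RHS]big_nat_recl // !subn0; congr (_ + _).
by rewrite -sumrN; apply: eq_bigr => i _; rewrite exprS mulN1r scaleNr subSS.
Qed.

End SignedSum.

(** * Staircase words *)

Section Staircase.

Variables (W : lmodType rat) (m : nat).
Implicit Types (u : seq (seq bool)) (a c k : nat).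

Definition stair s : seq bool := mkseq (fun t => (t < s)%N) m.
Definition skip a c : seq nat :=
  iota 0 a ++ iota a.+1 (c - a.+1) ++ iota c.+1 (m - c).
(** For a < k < c this column is not of staircase shape. At the boundary values c = k and a = k it
    is, which separates the boundary terms from the inner ones below. *)
Definition gap a k c : seq bool :=
  mkseq (fun t => (t < a) || (k <= t < c))%N m.
Definition lcols k a c : seq (seq bool) :=
  rcons (map stair (skip a c)) (gap a k c).
Definition stair_but k : seq (seq bool) :=
  map stair (iota 0 k ++ iota k.+1 (m - k)).

(** [sumD] and [sumC] are the ranges of skipped columns for the numerator of rho_k and for the
    denominator of rho_(k+1), both with gap start [k]. They share [sumM] and differ in the
    boundaries c = k and a = k. *)
Definition sumD k (f : nat -> nat -> W) : W :=
  \sum_(0 <= a < k) \sum_(k <= c < m.+1) (-1) ^+ (a + c) *: f a c.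
Definition sumC k (f : nat -> nat -> W) : W :=
  \sum_(0 <= a < k.+1) \sum_(k.+1 <= c < m.+1) (-1) ^+ (a + c) *: f a c.
Definition sumM k (f : nat -> nat -> W) : W :=
  \sum_(0 <= a < k) \sum_(k.+1 <= c < m.+1) (-1) ^+ (a + c) *: f a c.

Lemma size_lcols k a c : (a < c <= m)%N -> size (lcols k a c) = m.
Proof. by rewrite size_rcons size_map !size_cat !size_iota; lia. Qed.

Lemma size_stair_but k : (k <= m)%N -> size (stair_but k) = m.
Proof. by rewrite size_map !size_cat !size_iota; lia. Qed.

Lemma gap_stairl a k : gap a k k = stair a.
Proof. by apply: eq_mkseq => t; lia. Qed.

Lemma gap_stairr k c : (k <= c)%N -> gap k k c = stair c.
Proof. by move=> lekc; apply: eq_mkseq => t; lia. Qed.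

(** Here the added column is the skipped [stair a], put at the end; bringing it back to its place
    crosses the m - a - 1 remaining columns of larger index. *)
Lemma lcols_l (g : seq (seq bool) -> W) k a : alternating m g ->
    (a < k <= m)%N ->
  g (lcols k a k) = (-1) ^+ (m - a.+1) *: g (stair_but k).
Proof.
move=> altg /andP[ltak lekm].
have -> : stair_but k = map stair (iota 0 a)
    ++ stair a :: map stair (iota a.+1 (k - a.+1) ++ iota k.+1 (m - k)) ++ [::].
  rewrite cats0 -map_cons -map_cat -cat_cons catA; congr (map _ (_ ++ _)).
  have kE : k = (a + (k - a.+1).+1)%N by lia.
  by rewrite {1}kE iotaD.
rewrite (alternating_move altg); last first.
  by rewrite !size_cat /= !size_cat !size_map !size_cat !size_iota /=; lia.
rewrite scalerA !size_map size_cat !size_iota -exprD.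
rewrite (_ : (_ + _ = (m - a.+1).*2)%N); last by lia.
rewrite -signr_odd odd_double expr0 scale1r; congr g.
by rewrite /lcols /skip gap_stairl -cats1 !map_cat -!catA.
Qed.

Lemma lcols_r (g : seq (seq bool) -> W) k c : alternating m g ->
    (k < c <= m)%N ->
  g (lcols k k c) = (-1) ^+ (m - c) *: g (stair_but k).
Proof.
move=> altg /andP[ltkc lecm].
have -> : stair_but k = map stair (iota 0 k ++ iota k.+1 (c - k.+1))
      ++ stair c :: map stair (iota c.+1 (m - c)) ++ [::].
  rewrite cats0 -map_cons -map_cat -catA; congr (map _ (_ ++ _)).
  rewrite (_ : m - k = (c - k.+1) + (m - c).+1)%N; last by lia.
  by rewrite iotaD /= addnC subnK.
rewrite (alternating_move altg); last first.
  by rewrite !size_cat /= !size_cat !size_map !size_cat !size_iota /=; lia.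
rewrite scalerA !size_map !size_iota -exprD addnn.
rewrite -signr_odd odd_double expr0 scale1r; congr g.
by rewrite /lcols /skip gap_stairr 1?ltnW // -cats1 !map_cat -!catA.
Qed.

(** In the boundary terms c = k the sign of the sum and that of [lcols_l] combine to one independent
    of [a], so they add up to k copies of one value. *)
Lemma sumD_lcols (g : seq (seq bool) -> W) k : alternating m g -> (k <= m)%N ->
  sumD k (fun a c => g (lcols k a c)) =
  (k%:R * (-1) ^+ (k + m).+1) *: g (stair_but k)
  + sumM k (fun a c => g (lcols k a c)).
Proof.
move=> altg lekm; rewrite /sumD /sumM.
rewrite -[k in k%:R](subn0 k) -sumr_const_nat mulr_suml scaler_suml -big_split /=.
apply: eq_big_nat => a /andP[_ ltak]; rewrite big_ltn ?ltnS //; congr (_ + _).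
rewrite lcols_l ?ltak // scalerA -exprD mul1r.
by congr (_ *: _); rewrite -signr_odd -[RHS]signr_odd; congr (_ ^+ nat_of_bool _); lia.
Qed.

Lemma sumC_lcols (g : seq (seq bool) -> W) k : alternating m g -> (k <= m)%N ->
  sumC k (fun a c => g (lcols k a c)) =
  - ((m - k)%:R * (-1) ^+ (k + m).+1) *: g (stair_but k)
  + sumM k (fun a c => g (lcols k a c)).
Proof.
move=> altg lekm; rewrite /sumC /sumM big_nat_recr //= addrC; congr (_ + _).
rewrite -[(m - k)%N]subSS -sumr_const_nat mulr_suml -sumrN scaler_suml.
apply: eq_big_nat => c /andP[ltkc lecm]; rewrite lcols_r ?ltkc //.
rewrite scalerA -exprD mul1r exprS mulN1r opprK.
by congr (_ *: _); rewrite -signr_odd -[RHS]signr_odd; congr (_ ^+ nat_of_bool _); lia.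
Qed.

Variable phi : seq (seq bool) -> W.
Hypothesis phi_alt : alternating (2 * m) phi.

Let neg := map (map negb).
Let B u u' := phi (u ++ neg u').

(** For [phi := col_word v] this is, up to sign, the alternated product of consecutive minors that
    makes up the symbol of Gr_m. *)
Definition stair_word : W :=
  phi (map stair (iota 0 m.+1) ++ neg (map stair (iota 1 m.-1))).

Lemma alternating_l u' : size u' = m -> alternating m (B^~ u').
Proof.
move=> szu' s1 x y s2 szm; rewrite /B -!catA /= phi_alt // size_cat size_map.
by lia.
Qed.

Lemma alternating_r u : size u = m -> alternating m (B u).
Proof.
move=> szu s1 x y s2 szm; rewrite /B /neg !map_cat !catA /= phi_alt //.
rewrite size_cat !size_map. lia.
Qed.

Lemma alternating_sumM k (G : seq (seq bool) -> nat -> nat -> W) :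
    (k <= m)%N ->
    (forall a c, (a < c <= m)%N -> alternating m (fun u => G u a c)) ->
  alternating m (fun u => sumM k (G u)).
Proof.
move=> lekm altG s1 x y s2 szm; rewrite /sumM -sumrN.
apply: eq_big_nat => a /andP[_ ltak]; rewrite -sumrN.
by apply: eq_big_nat => c ltkc; rewrite -scalerN altG //; lia.
Qed.

Lemma sumM_lin k r (f g : nat -> nat -> W) :
  sumM k (fun a c => r *: f a c + g a c) = r *: sumM k f + sumM k g.
Proof.
rewrite /sumM scaler_sumr -big_split /=; apply: eq_bigr => a _.
rewrite scaler_sumr -big_split /=; apply: eq_bigr => c _.
by rewrite scalerDr !scalerA mulrC.
Qed.

Lemma eq_sumD k f g :
    (forall a c, (a < k)%N -> (k <= c <= m)%N -> f a c = g a c) ->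
  sumD k f = sumD k g.
Proof.
move=> eqfg; apply: eq_big_nat => a ak; apply: eq_big_nat => c kc.
by rewrite eqfg //; lia.
Qed.

Lemma eq_sumC k f g :
    (forall a c, (a <= k)%N -> (k < c <= m)%N -> f a c = g a c) ->
  sumC k f = sumC k g.
Proof.
move=> eqfg; apply: eq_big_nat => a ak; apply: eq_big_nat => c kc.
by rewrite eqfg //; lia.
Qed.

(** Both products are expanded by bilinearity. The parts with an inner gap on both sides occur in
    each and cancel, which leaves only terms with at least one factor [stair_but k]. *)
Lemma sumDC k : (k <= m)%N ->
  sumD k (fun a c => sumD k (fun a' c' => B (lcols k a c) (lcols k a' c')))
  - sumC k (fun a c => sumC k (fun a' c' => B (lcols k a c) (lcols k a' c')))
  = (k%:R ^+ 2 - (m - k)%:R ^+ 2) *: B (stair_but k) (stair_but k)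
  + (m%:R * (-1) ^+ (k + m).+1) *:
      (sumM k (fun a c => B (stair_but k) (lcols k a c))
       + sumM k (fun a c => B (lcols k a c) (stair_but k))).
Proof.
move=> lekm; have szk := size_stair_but lekm.
pose M u := sumM k (fun a' c' => B u (lcols k a' c')).
have altM : alternating m M.
  apply: alternating_sumM => // a c lac.
  by apply: alternating_l; rewrite size_lcols.
set s := (-1) ^+ (k + m).+1.
have DB u : size u = m -> sumD k (fun a' c' => B u (lcols k a' c'))
    = (k%:R * s) *: B u (stair_but k) + M u.
  by move=> szu; rewrite sumD_lcols //; apply: alternating_r.
have CB u : size u = m -> sumC k (fun a' c' => B u (lcols k a' c'))
    = - ((m - k)%:R * s) *: B u (stair_but k) + M u.
  by move=> szu; rewrite sumC_lcols //; apply: alternating_r.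
have altX r : alternating m (fun u => r *: B u (stair_but k) + M u).
  move=> s1 x y s2 szm; rewrite altM // alternating_l //.
  by rewrite scalerN opprD.
pose X r u := r *: B u (stair_but k) + M u.
rewrite (eq_sumD (g := fun a c => X (k%:R * s) (lcols k a c))); last first.
  move=> a c ak /andP[kc cm].
  by rewrite DB // size_lcols // cm (leq_trans ak kc).
rewrite (eq_sumC (g := fun a c => X (- ((m - k)%:R * s)) (lcols k a c))); last first.
  move=> a c ak /andP[kc cm].
  by rewrite CB // size_lcols // cm (leq_ltn_trans ak kc).
rewrite sumD_lcols ?sumC_lcols //; try exact: altX.
rewrite /X !sumM_lin -/(M (stair_but k)) -/s !scalerDr !scalerA.
move: (B _ _) (M _) (sumM _ _) (sumM _ _) => x y z t.
have sumE (a b c a' b' c' : W) :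
    (a + b + (c + z)) - (a' + b' + (c' + z)) = (a - a') + ((b - b') + (c - c')).
  by rewrite !opprD addrACA (addrACA a) (addrACA c) subrr addr0 -addrA.
rewrite sumE -!scalerBl.
have ss : s * s = 1 by rewrite -expr2 sqrr_sign.
rewrite natrB //.
by congr (_ *: _ + (_ *: _ + _ *: _)); ring: ss.
Qed.

Lemma neg_stair0 : map negb (stair 0) = stair m.
Proof.
by rewrite /stair /mkseq -map_comp; apply/eq_in_map => t /=; rewrite mem_iota; lia.
Qed.

Lemma neg_stairm : map negb (stair m) = stair 0.
Proof.
by rewrite /stair /mkseq -map_comp; apply/eq_in_map => t /=; rewrite mem_iota; lia.
Qed.

Lemma neg_gap k : map negb (gap 0 k m) = stair k.
Proof.
by rewrite /gap /stair /mkseq -map_comp; apply/eq_in_map => t /=; rewrite mem_iota; lia.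
Qed.

Lemma neg_stair_gap k : map negb (stair k) = gap 0 k m.
Proof.
by rewrite /gap /stair /mkseq -map_comp; apply/eq_in_map => t /=; rewrite mem_iota; lia.
Qed.

Lemma iota1_rcons : (0 < m)%N -> iota 1 m = iota 1 m.-1 ++ [:: m].
Proof.
move=> m_gt0; have {1}-> : m = (m.-1 + 1)%N by rewrite addn1 prednK.
by rewrite iotaD add1n prednK.
Qed.

(** Since complementing exchanges [stair 0] and [stair m], the two arrangements differ by a cyclic
    rotation of 2m columns, an odd permutation. *)
Lemma stair_word_rot : (0 < m)%N ->
  phi (map stair (iota 1 m.-1) ++ neg (map stair (iota 0 m.+1))) = - stair_word.
Proof.
move=> m_gt0.
have iotaE : iota 0 m.+1 = 0%N :: iota 1 m.-1 ++ [:: m].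
  by rewrite -iota1_rcons.
pose u := map stair (iota 1 m.-1).
have uE : map stair (iota 0 m.+1) = stair 0 :: u ++ [:: stair m].
  by rewrite iotaE /= map_cat.
rewrite /stair_word uE -/u.
have negE : neg (stair 0 :: u ++ [:: stair m]) = stair m :: neg u ++ [:: stair 0].
  by rewrite /neg /= map_cat /= neg_stair0 neg_stairm.
have := @alternating_move _ _ _ _ _ phi_alt [::] (stair 0) (u ++ stair m :: neg u) [::].
rewrite !cats0 cat0s negE cat_cons -!catA cat1s => ->; last first.
  by rewrite /= !size_cat /= !size_map !size_iota; lia.
rewrite -signr_odd size_cat /= !size_map !size_iota addnS /= addnn odd_double.
by rewrite expr1 scaleN1r opprK.
Qed.

Lemma shared_col u u' x : size u = m -> size u' = m ->
  x \in u -> x \in neg u' -> B u u' = 0.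
Proof.
move=> szu szu' xu xu'; apply: alternating_dup phi_alt _ _.
  by rewrite size_cat size_map szu szu' addnn mul2n.
rewrite cat_uniq; apply/negP => /and3P[_ /hasPn xN _].
by case/negP: (xN _ xu').
Qed.

Lemma diag_0 : (0 < m)%N -> B (stair_but 0) (stair_but 0) = - stair_word.
Proof.
move=> m_gt0; rewrite -stair_word_rot // /B /stair_but subn0 {1}iota1_rcons //.
by rewrite /neg /= map_cat -catA /= neg_stair0.
Qed.

Lemma diag_m : (0 < m)%N -> B (stair_but m) (stair_but m) = stair_word.
Proof.
move=> m_gt0; rewrite /B /stair_but subnn /= cats0 /stair_word.
rewrite -addn1 iotaD map_cat /= -catA /=; congr (phi (_ ++ _)).
by rewrite -[in iota 0 m](prednK m_gt0) /= neg_stair0.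
Qed.

Lemma diag_mid k : (0 < k < m)%N -> B (stair_but k) (stair_but k) = 0.
Proof.
move=> kP; apply: (@shared_col _ _ (stair 0)); rewrite ?size_stair_but; try lia.
  by apply: map_f; rewrite mem_cat !mem_iota; lia.
by rewrite -neg_stairm; apply/map_f/map_f; rewrite mem_cat !mem_iota; lia.
Qed.

Lemma sumM_corner k (f : nat -> nat -> W) : (0 < k < m)%N ->
    (forall a c, (a < k)%N -> (k < c <= m)%N -> (a != 0)%N || (c != m) ->
       f a c = 0) ->
  sumM k f = (-1) ^+ m *: f 0%N m.
Proof.
move=> /andP[k0 km] f0; rewrite /sumM big_ltn // big_nat_recr //= [X in _ + X]big_nat.
rewrite [X in X + _ + _]big_nat.
rewrite !big1 ?add0r ?addr0 //.
  move=> a /andP[a0 ak]; rewrite big_nat big1 // => c /andP[kc cm].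
  by rewrite f0 ?scaler0 //; lia.
by move=> c /andP[kc cm]; rewrite f0 ?scaler0 //; lia.
Qed.

(** Only the skipped pair (0, m) survives: any other leaves [stair 0] or [stair m] in [lcols], whose
    complement already occurs on the left. For (0, m) the complement of the gap column is [stair k],
    exactly the column missing from [stair_but k]. *)
Lemma cross_r k : (0 < k < m)%N ->
  sumM k (fun a c => B (stair_but k) (lcols k a c))
  = (-1) ^+ (k + m).+1 *: stair_word.
Proof.
move=> kP; rewrite sumM_corner // => [|a c ak kc]; last first.
  move=> /orP[a0|cm].
    apply: (@shared_col _ _ (stair m)).
    - by rewrite size_stair_but; lia.
    - by rewrite size_lcols; lia.
    - by apply: map_f; rewrite mem_cat !mem_iota; lia.
    - rewrite -neg_stair0; apply: map_f; rewrite mem_rcons inE; apply/orP; right.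
      by apply: map_f; rewrite !mem_cat !mem_iota; lia.
  apply: (@shared_col _ _ (stair 0)).
  - by rewrite size_stair_but; lia.
  - by rewrite size_lcols; lia.
  - by apply: map_f; rewrite mem_cat !mem_iota; lia.
  - rewrite -neg_stairm; apply: map_f; rewrite mem_rcons inE; apply/orP; right.
    by apply: map_f; rewrite !mem_cat !mem_iota; lia.
have uE : map stair (iota 0 m.+1) = map stair (iota 0 k)
    ++ stair k :: map stair (iota k.+1 (m - k)).
  rewrite -map_cons -map_cat; congr map.
  by rewrite (_ : m.+1 = k + (m - k).+1)%N ?iotaD //; lia.
have := @alternating_move _ _ _ _ _ phi_alt (map stair (iota 0 k)) (stair k)
  (map stair (iota k.+1 (m - k)) ++ neg (map stair (iota 1 m.-1))) [::].
rewrite /stair_word uE cats0 -!catA cat_cons => ->; last first.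
  by rewrite !size_cat /= !size_cat !size_map !size_iota; lia.
rewrite /B /lcols /skip /neg map_rcons neg_gap -cats1 /= subn1 subnn cats0.
rewrite scalerA /stair_but map_cat -!catA size_cat !size_map !size_iota -exprD.
by congr (_ *: _); rewrite -signr_odd -[RHS]signr_odd; congr (_ ^+ nat_of_bool _); lia.
Qed.

(** Mirror image of [cross_r]: the gap column fills the hole among the complemented columns, and
    [stair_word_rot] restores the standard form. *)
Lemma cross_l k : (0 < k < m)%N ->
  sumM k (fun a c => B (lcols k a c) (stair_but k))
  = (-1) ^+ (k + m).+1 *: stair_word.
Proof.
move=> kP; rewrite sumM_corner // => [|a c ak kc]; last first.
  move=> /orP[a0|cm].
    apply: (@shared_col _ _ (stair 0)).
    - by rewrite size_lcols; lia.
    - by rewrite size_stair_but; lia.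
    - rewrite mem_rcons inE; apply/orP; right.
      by apply: map_f; rewrite !mem_cat !mem_iota; lia.
    - by rewrite -neg_stairm; apply/map_f/map_f; rewrite mem_cat !mem_iota; lia.
  apply: (@shared_col _ _ (stair m)).
  - by rewrite size_lcols; lia.
  - by rewrite size_stair_but; lia.
  - rewrite mem_rcons inE; apply/orP; right.
    by apply: map_f; rewrite !mem_cat !mem_iota; lia.
  - by rewrite -neg_stair0; apply/map_f/map_f; rewrite mem_cat !mem_iota; lia.
rewrite -[stair_word]opprK -stair_word_rot; last by lia.
have uE : neg (map stair (iota 0 m.+1)) = neg (map stair (iota 0 k))
    ++ map negb (stair k) :: neg (map stair (iota k.+1 (m - k))).
  rewrite -[_ :: _]/(neg (stair k :: _)) -map_cat -map_cons -map_cat.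
  by rewrite (_ : m.+1 = k + (m - k).+1)%N ?iotaD //; lia.
have := @alternating_move _ _ _ _ _ phi_alt (map stair (iota 1 m.-1))
  (map negb (stair k)) (neg (map stair (iota 0 k)))
  (neg (map stair (iota k.+1 (m - k)))).
rewrite -uE /B /lcols /skip -neg_stair_gap -cats1 /= subn1 subnn cats0.
rewrite /stair_but map_cat /neg map_cat -/neg -!catA cat1s => ->; last first.
  by rewrite !size_cat /= !size_cat !size_map !size_iota; lia.
rewrite scalerA !size_map size_iota -exprD scalerN -scaleNr.
rewrite exprS mulN1r opprK.
by congr (_ *: _); rewrite addnC.
Qed.

(** Regrouping by gap start pairs [D k] with [C k]. The values k = 0 and k = m contribute m^2 each
    and the m - 1 inner values 2m each, and 2m^2 + 2m(m - 1) = 2m(2m - 1). *)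
Lemma staircase_sum : (0 < m)%N ->
  \sum_(1 <= k < m.+1)
    (sumD k (fun a c => sumD k (fun a' c' => B (lcols k a c) (lcols k a' c')))
     - sumC k.-1 (fun a c => sumC k.-1 (fun a' c' =>
                    B (lcols k.-1 a c) (lcols k.-1 a' c'))))
  = (2 * m * (2 * m - 1))%:R *: stair_word.
Proof.
move=> m_gt0.
pose D k := sumD k (fun a c => sumD k (fun a' c' => B (lcols k a c) (lcols k a' c'))).
pose C k := sumC k (fun a c => sumC k (fun a' c' => B (lcols k a c) (lcols k a' c'))).
(* The empty terms [D 0] and [C m] let both sums run over 0 <= k <= m. *)
have D0 : D 0%N = 0 by rewrite /D /sumD big_geq.
have Cm : C m = 0.
  by rewrite /C /sumC big1_seq // => a _; rewrite big_geq.
rewrite sumrB big_add1 /= [X in _ - X]big_add1 /=.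
have -> : \sum_(0 <= k < m) D k.+1 = \sum_(0 <= k < m.+1) D k.
  by rewrite big_nat_recl // D0 add0r.
have -> : \sum_(0 <= k < m) C k = \sum_(0 <= k < m.+1) C k.
  by rewrite big_nat_recr //= Cm addr0.
rewrite -sumrB big_nat_recr // big_ltn //=.
rewrite [D 0 - _]sumDC // [D m - _]sumDC //.
have M0 f : sumM 0 f = 0 by rewrite /sumM big_geq.
have Mm f : sumM m f = 0 by rewrite /sumM big1_seq // => a _; rewrite big_geq.
rewrite !M0 !Mm diag_0 // diag_m // !addr0 !scaler0 !addr0 subn0 subnn.
rewrite (eq_big_nat _ _ (F2 := fun=> (2 * m)%:R *: stair_word)); last first.
  move=> k kP; rewrite /D /C sumDC ?diag_mid //; last by lia.
  rewrite cross_r // cross_l // scaler0 add0r -scalerDl scalerA.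
  have ss : (-1) ^+ (k + m).+1 * (-1) ^+ (k + m).+1 = 1 :> rat.
    by rewrite -expr2 sqrr_sign.
  by congr (_ *: _); rewrite natrM; ring: ss.
rewrite sumr_const_nat -scaler_nat scalerA scalerN -scaleNr -!scalerDl.
by congr (_ *: _); rewrite !natrM !natrB ?muln_gt0 // natrM; ring.
Qed.

End Staircase.

(** * Words of bits *)

Section BitRows.

Variables (W : lmodType rat) (m : nat).

Lemma bsum_exchange n1 n2 (h : seq bool -> seq bool -> W) :
  bsum n1 (fun s => bsum n2 (h s)) = bsum n2 (fun t => bsum n1 (h^~ t)).
Proof.
elim: n1 h => [|n1 IH] h //=.
rewrite (IH (fun s => h (false :: s))) (IH (fun s => h (true :: s))).
by rewrite -bsumB.
Qed.

(** The pair holds a threshold and a bit; it stands for one half of a letter a_i, namely (x, b) on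
    the left or (y, c) on the right. *)
Definition entry i (b : bool) : nat * bool := ((i + b).-1, b).

Fixpoint entries i (s : seq bool) : seq (nat * bool) :=
  if s is b :: s' then entry i b :: entries i.+1 s' else [::].

(** This is the left half of the incidence matrix: the points 1, ..., m - 1, then Q. The right half,
    with m, ..., 2m - 2 and then P, has the same form up to complement. *)
Definition cols (d : seq (nat * bool)) : seq (seq bool) :=
  rcons [seq [seq (e.1 < j)%N | e <- d] | j <- iota 1 m.-1] (map snd d).

Lemma size_cols d : (0 < m)%N -> size (cols d) = m.
Proof. by move=> m_gt0; rewrite size_rcons size_map size_iota prednK. Qed.

Lemma size_entries i s : size (entries i s) = size s.
Proof. by elim: s i => //= b s IH i; rewrite IH. Qed.

Lemma entries_cat i s1 s2 :
  entries i (s1 ++ s2) = entries i s1 ++ entries (i + size s1) s2.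
Proof. by elim: s1 i => [|b s1 IH] i /=; rewrite ?addn0 // IH addSnnS. Qed.

Lemma entries_nseq i n b : entries i (nseq n b) = [seq entry j b | j <- iota i n].
Proof. by elim: n i => //= n IH i; rewrite IH. Qed.

Lemma entries_bound i s x :
  x \in map fst (entries i s) -> (i.-1 <= x < i + size s)%N.
Proof.
elim: s i => //= b s IH i; rewrite inE => /orP[/eqP->|/IH]; last by lia.
by case: b; rewrite /=; lia.
Qed.

(** If no threshold equals [v], the columns of the points v and v + 1 coincide. *)
Lemma cols_gap (g : seq (seq bool) -> W) d v : alternating m g ->
  (0 < v)%N -> (v.+1 < m)%N -> v \notin map fst d -> g (cols d) = 0.
Proof.
move=> altg v0 vm vd; apply: (alternating_dup altg).
  by rewrite size_cols //; lia.
apply/negP; rewrite rcons_uniq => /andP[_ /(uniqP [::])].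
move=> /(_ v.-1 v); rewrite !inE size_map size_iota.
have nthE j : (j < m.-1)%N ->
  nth [::] [seq [seq (e.1 < j)%N | e <- d] | j <- iota 1 m.-1] j
  = [seq (e.1 < j.+1)%N | e <- d].
  by move=> jm; rewrite (nth_map 0%N) ?size_iota // nth_iota.
rewrite !nthE; try by lia.
suff /eq_in_map -> : {in d, (fun e => e.1 < v.-1.+1)%N =1 (fun e => e.1 < v.+1)%N}.
  by move=> H; have : v.-1 = v; [apply: H => //; lia | lia].
move=> e ed; rewrite prednK // ltnS [in RHS]leq_eqVlt.
by case: eqP vd => // <-; rewrite map_f.
Qed.

Lemma eq_map_iota (T : Type) (f g : nat -> T) a b n :
    (forall r, (r < n)%N -> f (a + r)%N = g (b + r)%N) ->
  map f (iota a n) = map g (iota b n).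
Proof.
move=> fg; rewrite -[a]addn0 -[b]addn0 !iotaDl -!map_comp.
by apply/eq_in_map => r; rewrite mem_iota => /andP[_ rn] /=; apply: fg.
Qed.

(** The middle row comes from the inserted rho_k: [eps] is [false] for its numerator and [true] for
    its denominator. *)
Definition monotone_rows k (eps : bool) a e : seq (nat * bool) :=
  entries 1 (nseq a true ++ nseq (k.-1 - a) false)
  ++ (k.-1, eps) :: entries k (nseq e true ++ nseq (m - k - e) false).

Lemma map_monotone_rows (T : Type) (f : nat * bool -> T) k eps a e :
  map f (monotone_rows k eps a e) =
  map (fun i => f (entry i true)) (iota 1 a)
  ++ map (fun i => f (entry i false)) (iota a.+1 (k.-1 - a))
  ++ f (k.-1, eps)
  :: map (fun i => f (entry i true)) (iota k e)
  ++ map (fun i => f (entry i false)) (iota (k + e) (m - k - e)).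
Proof.
rewrite /monotone_rows !entries_cat !entries_nseq !size_nseq add1n.
by rewrite -!catA !map_cat /= map_cat -!map_comp.
Qed.

Lemma iota_monotone k a e : (a < k)%N -> (k + e <= m)%N ->
  iota 0 m = iota 0 a ++ iota a (k.-1 - a) ++ k.-1 :: iota k e
             ++ iota (k + e) (m - k - e).
Proof.
move=> ak ke.
have -> : iota 0 m = iota 0 (a + ((k.-1 - a) + (e + (m - k - e)).+1)).
  by congr iota; lia.
have k1 : (a + (k.-1 - a) = k.-1)%N by lia.
by rewrite !iotaD /= iotaD add0n k1 (ltn_predK ak).
Qed.

(** The column of the point j is [stair s] with s the number of thresholds below j; s skips [a] and
    [k + e], where the two blocks of [true] end and the thresholds stall. *)
Lemma cols_monotone k eps a e : (a < k)%N -> (k + e <= m)%N ->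
  cols (monotone_rows k eps a e) = lcols m (k - eps) a (k + e).
Proof.
move=> ak ke; rewrite /cols /lcols; congr rcons; last first.
  rewrite map_monotone_rows /gap /mkseq (iota_monotone ak ke).
  rewrite !map_cat map_cons map_cat; congr (_ ++ (_ ++ _ :: _ ++ _)).
  - by apply: eq_map_iota => r rn /=; lia.
  - by apply: eq_map_iota => r rn /=; case: eps => /=; lia.
  - by case: eps => /=; lia.
  - by apply: eq_map_iota => r rn /=; case: eps => /=; lia.
  - by apply: eq_map_iota => r rn /=; case: eps => /=; lia.
have iotaE : iota 1 m.-1 = iota 1 a ++ iota a.+1 (k + e - a.+1)
    ++ iota (k + e) (m - (k + e)).
  rewrite (_ : m.-1 = a + ((k + e - a.+1) + (m - (k + e))))%N; last by lia.
  by rewrite !iotaD add1n addSn; congr (_ ++ (_ ++ iota _ _)); lia.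
have colE j s : [|| (j <= a) && (j == s.+1), (a < j < k + e) && (j == s)
                  | (k + e <= j) && (j.+1 == s)]%N ->
    [seq (d.1 < j)%N | d <- monotone_rows k eps a e] = stair m s.
  move=> js; rewrite map_monotone_rows /stair /mkseq (iota_monotone ak ke).
  rewrite !map_cat map_cons map_cat; congr (_ ++ (_ ++ _ :: _ ++ _)).
  - by apply: eq_map_iota => r rn /=; lia.
  - by apply: eq_map_iota => r rn /=; lia.
  - by move=> /=; lia.
  - by apply: eq_map_iota => r rn /=; lia.
  - by apply: eq_map_iota => r rn /=; lia.
rewrite iotaE /skip !map_cat; congr (_ ++ (_ ++ _));
  by apply: eq_map_iota => r rn; apply: colE; lia.
Qed.

(** Thresholds never decrease, and at an ascent they jump from v - 1 to v + 1. *)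
Lemma ascent_gap i s1 s2 :
  (0 < i)%N ->
  (i + size s1)%N \notin map fst (entries i (s1 ++ [:: false, true & s2])).
Proof.
move=> i0; rewrite entries_cat map_cat mem_cat /= !inE; apply/negP.
by move=> /orP[/entries_bound|/orP[|/orP[|/entries_bound]]]; lia.
Qed.

(** An ascent inside either block of bits misses a threshold and kills the word. An ascent across
    the inserted row does not, since that row supplies the threshold k - 1. With c = k + e the sign
    (-1)^(a + e) is (-1)^(a + c) times (-1)^k. *)
Lemma bsum_cols (g : seq (seq bool) -> W) k eps : alternating m g ->
    (0 < k <= m)%N ->
  bsum k.-1 (fun b1 => bsum (m - k) (fun b2 =>
    g (cols (entries 1 b1 ++ (k.-1, eps) :: entries k b2))))
  = (-1) ^+ k *: sumD m k (fun a c => g (lcols m (k - eps) a c)).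
Proof.
move=> altg /andP[k0 km]; rewrite bsum_monotone => [|s1 s2 sz]; last first.
  move: sz; rewrite size_cat /= => sz.
  rewrite -[RHS](_ : bsum (m - k) (fun=> 0) = 0 :> W); last first.
    by elim: (m - k)%N => //= n ->; rewrite subrr.
  apply: eq_bsum => b2 szb2; apply: (cols_gap (v := (1 + size s1)%N) altg) => //.
    by lia.
  rewrite map_cat mem_cat negb_or ascent_gap //= inE.
  by apply/norP; split; [|apply/negP => /entries_bound]; lia.
rewrite prednK // /sumD scaler_sumr; apply: eq_big_nat => a /andP[_ ak].
rewrite bsum_monotone => [|s1 s2 sz]; last first.
  move: sz; rewrite size_cat /= => sz.
  apply: (cols_gap (v := (k + size s1)%N) altg); try by lia.
  rewrite map_cat mem_cat negb_or /= inE negb_or ascent_gap // andbT.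
  rewrite -negb_or; apply/negP => /orP[/entries_bound|]; last by lia.
  by rewrite size_cat !size_nseq; lia.
have reindexE (F : nat -> W) :
    \sum_(k <= c < m.+1) F c = \sum_(0 <= e < (m - k).+1) F (e + k)%N.
  by rewrite -{1}[k]add0n big_addn subSn.
rewrite reindexE !scaler_sumr.
apply: eq_big_nat => e /andP[_ ek].
rewrite -/(monotone_rows k eps a e) cols_monotone //; last by lia.
rewrite addnC !scalerA -!exprD; congr (_ *: _).
by rewrite -signr_odd -[RHS]signr_odd; congr (_ ^+ nat_of_bool _); lia.
Qed.

Lemma sumD_scale k r (f : nat -> nat -> W) :
  sumD m k (fun a c => r *: f a c) = r *: sumD m k f.
Proof.
rewrite /sumD scaler_sumr; apply: eq_bigr => a _.
by rewrite scaler_sumr; apply: eq_bigr => c _; rewrite !scalerA mulrC.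
Qed.

Lemma alternating_sumD k (G : seq (seq bool) -> nat -> nat -> W) :
    (forall a c, (a < c <= m)%N -> alternating m (fun u => G u a c)) ->
  alternating m (fun u => sumD m k (G u)).
Proof.
move=> altG s1 x y s2 szm; rewrite /sumD -sumrN.
apply: eq_big_nat => a /andP[_ ltak]; rewrite -sumrN.
apply: eq_big_nat => c /andP[lekc lecm]; rewrite -scalerN altG //.
by rewrite (leq_trans ltak lekc).
Qed.

Variable phi : seq (seq bool) -> W.
Hypotheses (m_gt0 : (0 < m)%N) (phi_alt : alternating (2 * m) phi).

Definition rows_word (dl dr : seq (nat * bool)) : W :=
  phi (cols dl ++ map (map negb) (cols dr)).

Definition rows_sum k eps : W :=
  bsum k.-1 (fun b1 => bsum k.-1 (fun c1 =>
  bsum (m - k) (fun b2 => bsum (m - k) (fun c2 =>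
    rows_word (entries 1 b1 ++ (k.-1, eps) :: entries k b2)
              (entries 1 c1 ++ (k.-1, eps) :: entries k c2))))).

Lemma rows_sumE k eps : (0 < k <= m)%N ->
  rows_sum k eps = sumD m k (fun a c => sumD m k (fun a' c' =>
    phi (lcols m (k - eps) a c ++ map (map negb) (lcols m (k - eps) a' c')))).
Proof.
move=> kP.
pose G u := (-1) ^+ k *: sumD m k (fun a' c' =>
  phi (u ++ map (map negb) (lcols m (k - eps) a' c'))).
have altG : alternating m G.
  move=> s1 x y s2 szm; rewrite /G -scalerN; congr (_ *: _).
  apply: (@alternating_sumD k (fun u a' c' => phi (u ++ _))) szm => a c ac.
  by apply: alternating_l => //; rewrite size_lcols.
transitivity (bsum k.-1 (fun b1 => bsum (m - k) (fun b2 =>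
    G (cols (entries 1 b1 ++ (k.-1, eps) :: entries k b2))))).
  apply: eq_bsum => b1 _; rewrite bsum_exchange; apply: eq_bsum => b2 _.
  by rewrite (bsum_cols _ (alternating_r phi_alt _)) // size_cols.
by rewrite bsum_cols // sumD_scale scalerA -expr2 sqrr_sign scale1r.
Qed.

Lemma rows_sum_total :
  \sum_(1 <= k < m.+1) (rows_sum k false - rows_sum k true)
  = (2 * m * (2 * m - 1))%:R *: stair_word m phi.
Proof.
rewrite -staircase_sum //; apply: eq_big_nat => -[//|k] /andP[_ km].
(* For the denominator the gap starts at k - 1, and the range of [sumD k] is literally that of
   [sumC k.-1]. *)
by rewrite !rows_sumE ?km // subn0 subn1.
Qed.

End BitRows.

(** * Congruence modulo the tensor relations *)

Section TensorCongruence.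

Variable K : fieldType.
Implicit Types s t u : words K.

Definition teq s t := tensor_null (s - t).

Lemma tensor_null0 : tensor_null (0 : words K).
Proof.
have := tensor_nullM 0 0 (tensor_null_rel (oner_neq0 K) (oner_neq0 K)).
by rewrite mulr0.
Qed.

Lemma tensor_nullZ (c : rat) s : tensor_null s -> tensor_null (c *: s).
Proof.
move=> s0; have := tensor_nullM (c *: 1) 1 s0.
by rewrite mulr1 -scalerAl mul1r.
Qed.

Lemma tensor_nullN s : tensor_null s -> tensor_null (- s).
Proof. by move/(tensor_nullZ (-1)); rewrite scaleN1r. Qed.

Lemma teq_refl s : teq s s.
Proof. by rewrite /teq subrr; apply: tensor_null0. Qed.

Lemma teq_eq s t : s = t -> teq s t.
Proof. by move=> ->; apply: teq_refl. Qed.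

Lemma teq_sym s t : teq s t -> teq t s.
Proof. by move/tensor_nullN; rewrite opprB. Qed.

Lemma teq_trans t s u : teq s t -> teq t u -> teq s u.
Proof. by move=> st tu; have := tensor_nullD st tu; rewrite addrA subrK. Qed.

Lemma teqD s t s' t' : teq s t -> teq s' t' -> teq (s + s') (t + t').
Proof. by move=> st st'; have := tensor_nullD st st'; rewrite addrACA -opprD. Qed.

Lemma teqN s t : teq s t -> teq (- s) (- t).
Proof. by move/tensor_nullN; rewrite opprD. Qed.

Lemma teqB s t s' t' : teq s t -> teq s' t' -> teq (s - s') (t - t').
Proof. by move=> st /teqN; apply: teqD. Qed.

Lemma teqZ (c : rat) s t : teq s t -> teq (c *: s) (c *: t).
Proof. by move/(tensor_nullZ c); rewrite scalerBr. Qed.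

Lemma teqM s t s' t' : teq s t -> teq s' t' -> teq (s * s') (t * t').
Proof.
move=> st st'; apply: (teq_trans (t := t * s')).
  by have := tensor_nullM 1 s' st; rewrite mul1r mulrBl.
by have := tensor_nullM t 1 st'; rewrite mulr1 mulrBr.
Qed.

Lemma teq_sum I (r : seq I) (P : pred I) (F G : I -> words K) :
    (forall i, P i -> teq (F i) (G i)) ->
  teq (\sum_(i <- r | P i) F i) (\sum_(i <- r | P i) G i).
Proof.
by move=> FG; elim/big_rec2: _ => [|i s t Pi st]; [exact: teq_refl | exact: teqD (FG i Pi) st].
Qed.

Lemma teq_sum_nat m n (F G : nat -> words K) :
    (forall i, (m <= i < n)%N -> teq (F i) (G i)) ->
  teq (\sum_(m <= i < n) F i) (\sum_(m <= i < n) G i).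
Proof. by move=> FG; rewrite !big_nat; apply: teq_sum. Qed.

Lemma teq_prod I (r : seq I) (P : pred I) (F G : I -> words K) :
    (forall i, P i -> teq (F i) (G i)) ->
  teq (\prod_(i <- r | P i) F i) (\prod_(i <- r | P i) G i).
Proof.
by move=> FG; elim/big_rec2: _ => [|i s t Pi st]; [exact: teq_refl | exact: teqM (FG i Pi) st].
Qed.

Lemma teq_bsum n (F G : seq bool -> words K) :
  (forall r : seq bool, size r = n -> teq (F r) (G r)) -> teq (bsum n F) (bsum n G).
Proof.
elim: n F G => [|n IH] F G FG /=; first exact: FG.
by apply: teqB; apply: IH => s sz; apply: FG => /=; rewrite sz.
Qed.

Lemma teq_double s t : teq (2%:R *: s) (2%:R *: t) -> teq s t.
Proof.
rewrite /teq -scalerBr => /(tensor_nullZ 2%:R^-1).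
by rewrite (scalerK (isT : 2%:R != 0 :> rat)).
Qed.

Lemma letterM (x y : K) : x != 0 -> y != 0 ->
  teq (letter (x * y)) (letter x + letter y).
Proof. by move=> x0 y0; rewrite /teq opprD addrA; apply: tensor_null_rel. Qed.

Lemma letter1 : teq (letter (1 : K)) 0.
Proof.
have := letterM (oner_neq0 K) (oner_neq0 K); rewrite mulr1 /teq opprD addrA.
by rewrite subrr sub0r subr0 => /tensor_nullN; rewrite opprK.
Qed.

Lemma letterV (x : K) : x != 0 -> teq (letter x^-1) (- letter x).
Proof.
move=> x0; have xV0 : x^-1 != 0 by rewrite invr_eq0.
have := teq_trans (teq_sym (letterM x0 xV0)); rewrite divff //.
by move=> /(_ _ letter1); rewrite /teq subr0 opprK addrC.
Qed.

Lemma letter_div (x y : K) : x != 0 -> y != 0 ->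
  teq (letter (x / y)) (letter x - letter y).
Proof.
move=> x0 y0; apply: teq_trans (letterM x0 _) _; first by rewrite invr_eq0.
by apply: teqD; [apply: teq_refl | apply: letterV].
Qed.

Lemma letterN (x : K) : x != 0 -> teq (letter (- x)) (letter x).
Proof.
move=> x0; have N0 : - 1 != 0 :> K by rewrite oppr_eq0 oner_neq0.
(* Torsion dies over the rationals: twice the class of -1 is the class of 1. *)
have N1 : teq (letter (- 1 : K)) 0.
  apply: teq_double; rewrite scaler0 scaler_nat mulr2n.
  apply: teq_trans (teq_sym (letterM N0 N0)) _.
  by rewrite mulrNN mulr1; apply: letter1.
rewrite -mulN1r; apply: teq_trans (letterM N0 x0) _.
by apply: teq_trans (teqD N1 (teq_refl _)) _; rewrite add0r; apply: teq_refl.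
Qed.

(* A representative of [letter x] depending on [x] only up to sign, so that the
   antisymmetry of determinants becomes an equality in the free algebra. *)
Definition sletter (x : K) : words K := 2%:R^-1 *: (letter x + letter (- x)).

Lemma sletterN x : sletter (- x) = sletter x.
Proof. by rewrite /sletter opprK addrC. Qed.

Lemma sletter_sign x (b : bool) : sletter ((-1) ^+ b * x) = sletter x.
Proof. by case: b; [rewrite expr1 mulN1r; exact: sletterN | rewrite expr0 mul1r]. Qed.

Lemma sletterE x : x != 0 -> teq (letter x) (sletter x).
Proof.
move=> x0; apply: teq_double; rewrite scalerA divff // scale1r scaler_nat mulr2n.
by apply: teqD; [apply: teq_refl | apply/teq_sym/letterN].
Qed.

End TensorCongruence.

(** * Alternation over the symmetric group *)

Section Alternation.

Variables (n : nat) (T : Type).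

Definition permt (s : 'S_n) (v : n.-tuple T) : n.-tuple T :=
  [tuple tnth v (s i) | i < n].

Lemma permtM s s' v : permt s (permt s' v) = permt (s * s') v.
Proof. by apply: eq_from_tnth => i; rewrite !tnth_mktuple permM. Qed.

Variable W : lmodType rat.
Implicit Types f g : n.-tuple T -> W.

Lemma AltE f v : Alt f v = \sum_(s : 'S_n) (-1) ^+ s *: f (permt s v).
Proof. by []. Qed.

Lemma eq_Alt f g v : f =1 g -> Alt f v = Alt g v.
Proof. by move=> fg; apply: eq_bigr => s _; rewrite fg. Qed.

Lemma AltD f g v : Alt (fun w => f w + g w) v = Alt f v + Alt g v.
Proof. by rewrite /Alt -big_split; apply: eq_bigr => s _; rewrite scalerDr. Qed.

Lemma AltN f v : Alt (fun w => - f w) v = - Alt f v.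
Proof. by rewrite /Alt -sumrN; apply: eq_bigr => s _; rewrite scalerN. Qed.

Lemma AltB f g v : Alt (fun w => f w - g w) v = Alt f v - Alt g v.
Proof. by rewrite AltD AltN. Qed.

Lemma Alt_sum I (r : seq I) (F : I -> n.-tuple T -> W) v :
  Alt (fun w => \sum_(i <- r) F i w) v = \sum_(i <- r) Alt (F i) v.
Proof.
elim: r => [|i r IH].
  by rewrite big_nil; apply: big1 => s _; rewrite big_nil scaler0.
by rewrite big_cons -IH -AltD; apply: eq_Alt => w; rewrite big_cons.
Qed.

Lemma Alt_permt (t : 'S_n) f v :
  Alt (fun w => f (permt t w)) v = (-1) ^+ t *: Alt f v.
Proof.
rewrite !AltE [in RHS](reindex_inj (mulgI t)) scaler_sumr; apply: eq_bigr => s _.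
by rewrite permtM odd_permM signr_addb scalerA mulrA -expr2 sqrr_sign mul1r.
Qed.

Lemma Alt_symmetric (i j : 'I_n) f v :
  i != j -> (forall w, f (permt (tperm i j) w) = f w) -> Alt f v = 0.
Proof.
move=> ij fs; apply: eq_opp_0; rewrite -{1}(eq_Alt v fs).
by rewrite Alt_permt odd_tperm ij expr1 scaleN1r.
Qed.

End Alternation.

(** The congruence is asked only on the permutations of [v], where general position is inherited and
    the brackets are nonzero. *)
Lemma teq_Alt (K : fieldType) n T (f g : n.-tuple T -> words K) v :
  (forall s : 'S_n, teq (f (permt s v)) (g (permt s v))) -> teq (Alt f v) (Alt g v).
Proof. by move=> fg; apply: teq_sum => s _; apply: teqZ (fg s). Qed.

(** * Brackets *)

Lemma nth_swap (T : Type) (x0 : T) s1 x y s2 n (i j k : 'I_n) :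
    val i = size s1 -> val j = (size s1).+1 ->
  nth x0 (s1 ++ y :: x :: s2) k = nth x0 (s1 ++ x :: y :: s2) (tperm i j k).
Proof.
move=> iE jE; case: tpermP => [->|->|/eqP k1 /eqP k2].
- by rewrite iE jE !nth_cat ltnn ltnNge leqnSn /= subnn subSnn.
- by rewrite iE jE !nth_cat ltnn ltnNge leqnSn /= subnn subSnn.
rewrite !nth_cat; case: ltnP => // lek.
move: k1 k2; rewrite -!val_eqE /= iE jE.
by case: (k - size s1)%N (subnKC lek) => [|[|l]] //=; lia.
Qed.

Section Brackets.

Variables (K : fieldType) (m : nat).
Implicit Types (v : seq 'cV[K]_m) (s : seq nat) (w : (2 * m).-tuple 'cV[K]_m).

Lemma bracket_perm v s (p : 'S_m) (s' : seq nat) :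
    (forall j : 'I_m, nth 0%N s' j = nth 0%N s (p j)) ->
  bracket v s' = (-1) ^+ p * bracket v s.
Proof.
move=> ss'; rewrite /bracket; set M := (X in _ * \det X).
rewrite mulrC -(odd_permV p) -det_perm -det_mulmx -col_permE.
by congr (\det _); apply/matrixP => i j; rewrite !mxE ss'.
Qed.

Lemma bracket_alternating v : alternating m (bracket v : seq nat -> K^o).
Proof.
move=> s1 x y s2 szm.
have lt1 : (size s1 < m)%N by lia.
have lt2 : ((size s1).+1 < m)%N by lia.
have ij : Ordinal lt1 != Ordinal lt2 by rewrite -val_eqE /=; lia.
rewrite (@bracket_perm v (s1 ++ y :: x :: s2) (tperm (Ordinal lt1) (Ordinal lt2))).
  by rewrite odd_tperm ij expr1 mulN1r.
by move=> j; apply: nth_swap.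
Qed.

(** Ordinals count from 0, the labels of points from 1. *)
Definition pts (s : seq 'I_(2 * m)) : seq nat := [seq (val i).+1 | i <- s].

Lemma bracket_permt w (t : 'S_(2 * m)) (s : seq 'I_(2 * m)) : (m <= size s)%N ->
  bracket (permt t w) (pts s) = bracket w (pts (map t s)).
Proof.
move=> ms; rewrite /bracket; congr (\det _); apply/matrixP => i j; rewrite !mxE.
have js : (j < size s)%N by apply: leq_trans ms.
have [x _] : exists x : 'I_(2 * m), x \in s.
  by case: s js {ms} => // x s _; exists x; rewrite mem_head.
have ptsE u : (j < size u)%N -> nth 0%N (pts u) j = (val (nth x u j)).+1.
  exact: nth_map.
rewrite !ptsE ?size_map // (nth_map x _ _ js) /=.
by rewrite -(tnth_nth 0 (permt t w)) tnth_mktuple (tnth_nth 0).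
Qed.

Definition generic_position w : Prop :=
  forall s : seq 'I_(2 * m), uniq s -> size s = m -> bracket w (pts s) != 0.

Lemma generic_position_permt t w :
  generic_position w -> generic_position (permt t w).
Proof.
move=> gw s us sm; rewrite bracket_permt ?sm //.
by apply: gw; rewrite ?size_map // map_inj_uniq //; apply: perm_inj.
Qed.

(** A set of labels determines the letter because [sletter] ignores the sign of the bracket. The
    value 0 for a set of the wrong size keeps the words of arbitrary incidence matrices defined and
    alternating. *)
Definition minor_letter w (P : pred nat) : words K :=
  let s := filter P (iota 1 (2 * m)) in
  if size s == m then sletter (bracket w s) else 0.

Lemma eq_minor_letter w P Q :
  {in iota 1 (2 * m), P =1 Q} -> minor_letter w P = minor_letter w Q.
Proof. by move=> /eq_in_filter PQ; rewrite /minor_letter PQ. Qed.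

Lemma bracket_perm_eq v s s' : size s = m -> perm_eq s s' ->
  exists b : bool, bracket v s = (-1) ^+ b * bracket v s'.
Proof.
move=> szs ss'; have szs' : size s' == m by rewrite -(perm_size ss') szs.
have /tuple_permP[p sE] : perm_eq s (Tuple szs') by [].
exists p; apply: bracket_perm => j.
by rewrite sE -tnth_nth tnth_mktuple (tnth_nth 0%N).
Qed.

Lemma sletter_bracket v s s' : size s = m -> perm_eq s s' ->
  sletter (bracket v s) = sletter (bracket v s').
Proof.
by move=> szs /(bracket_perm_eq v szs)[b ->]; apply: sletter_sign.
Qed.

Lemma filter_pts P :
  filter P (iota 1 (2 * m)) = pts [seq i <- enum 'I_(2 * m) | P (val i).+1].
Proof.
have -> : iota 1 (2 * m) = pts (enum 'I_(2 * m)).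
  by rewrite /pts (map_comp S val) val_enum_ord -(iotaDl 1 0).
by rewrite filter_map.
Qed.

Lemma minor_letter_permt w (t : 'S_(2 * m)) P Q :
    (forall i : 'I_(2 * m), Q (t i).+1 = P i.+1) ->
  minor_letter (permt t w) P = minor_letter w Q.
Proof.
move=> QP; rewrite /minor_letter !filter_pts.
set s := [seq i <- _ | _]; set s' := [seq i <- _ | Q _].
have ss' : perm_eq (map t s) s'.
  apply: uniq_perm.
  - by rewrite (map_inj_uniq (@perm_inj _ t)); apply/filter_uniq/enum_uniq.
  - exact/filter_uniq/enum_uniq.
  move=> x; rewrite -[x](permKV t) mem_map; last exact: perm_inj.
  by rewrite mem_filter [RHS]mem_filter !mem_enum -QP.
have szs := perm_size ss'; rewrite size_map in szs; clearbody s s'.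
rewrite !size_map szs; case: eqP => [sm|_]; last by [].
rewrite bracket_permt ?szs ?sm ?leqnn; last by [].
apply: sletter_bracket; first by rewrite !size_map szs.
exact: perm_map.
Qed.

Lemma perm_eq_filter s P : uniq s ->
    (forall j, (j \in s) = (0 < j <= 2 * m)%N && P j) ->
  perm_eq s (filter P (iota 1 (2 * m))).
Proof.
move=> us sP; apply: uniq_perm => //; first by rewrite filter_uniq ?iota_uniq.
by move=> j; rewrite sP mem_filter mem_iota andbC add1n ltnS.
Qed.

Lemma bracket_neq0 w s : generic_position w -> uniq s -> size s = m ->
  (forall j, j \in s -> 0 < j <= 2 * m)%N -> bracket w s != 0.
Proof.
move=> gw us sm sP.
have sf : perm_eq s (filter (mem s) (iota 1 (2 * m))).
  apply: perm_eq_filter => // j /=.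
  by case: (boolP (j \in s)) => [/sP->|_]; rewrite ?andbF.
have [b ->] := bracket_perm_eq w sm sf.
rewrite mulf_neq0 ?signr_eq0 // filter_pts; apply: gw.
  by rewrite filter_uniq ?enum_uniq.
by rewrite -(size_map (fun i => (val i).+1)) -/(pts _) -filter_pts -(perm_size sf).
Qed.

Lemma letter_bracketE w s P : generic_position w -> uniq s -> size s = m ->
    (forall j, (j \in s) = (0 < j <= 2 * m)%N && P j) ->
  teq (letter (bracket w s)) (minor_letter w P).
Proof.
move=> gw us sm sP; have sf := perm_eq_filter us sP.
rewrite /minor_letter -(perm_size sf) sm eqxx -(sletter_bracket _ sm sf).
by apply: sletterE; apply: bracket_neq0 => // j; rewrite sP => /andP[].
Qed.

End Brackets.

(** * Incidence matrices *)

Section Columns.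

Variables (K : fieldType) (m : nat).
Implicit Types (w v : (2 * m).-tuple 'cV[K]_m) (C : seq (seq bool)).

Definition row_pred C t : pred nat := fun j => nth false (nth [::] C j.-1) t.

(** Each row of [C] is the set of points of one letter. Rows are numbered in the order of deletion,
    and the recursion puts the first deleted letter rightmost, whence [rev]. *)
Definition col_word v C : words K :=
  Alt (fun w => \prod_(t <- rev (iota 0 m)) minor_letter w (row_pred C t)) v.

(** Exchanging two adjacent columns amounts to transposing the two points in every letter, which
    [Alt] turns into a sign. *)
Lemma col_word_alternating v : alternating (2 * m) (col_word v).
Proof.
move=> s1 x y s2 szm.
have lt1 : (size s1 < 2 * m)%N by lia.
have lt2 : ((size s1).+1 < 2 * m)%N by lia.
have ij : Ordinal lt1 != Ordinal lt2 by rewrite -val_eqE /=; lia.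
have sgn : (-1) ^+ tperm (Ordinal lt1) (Ordinal lt2) = - 1 :> rat.
  by rewrite odd_tperm ij.
rewrite /col_word -scaleN1r -sgn -Alt_permt; apply: eq_Alt => w; apply: eq_bigr => t _.
apply/esym/minor_letter_permt => i; rewrite /row_pred /=.
by rewrite [in RHS](@nth_swap _ _ _ _ _ _ _ (Ordinal lt1) (Ordinal lt2)).
Qed.

(** The set x < j <= y + m - 1 with P and Q the points 2m - 1 and 2m; left of m only x matters, from
    m on only y. *)
Definition row_of (e : (nat * bool) * (nat * bool)) : pred nat := fun j =>
  if (j < m)%N then (e.1.1 < j)%N
  else if (j < (2 * m).-1)%N then ~~ (e.2.1 < j - m.-1)%N
  else if (j == (2 * m).-1)%N then ~~ e.2.2 else e.1.2.

Definition row_word w (d : seq ((nat * bool) * (nat * bool))) : words K :=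
  \prod_(e <- rev d) minor_letter w (row_of e).

Lemma row_word_rcons w d e :
  row_word w (rcons d e) = minor_letter w (row_of e) * row_word w d.
Proof. by rewrite /row_word rev_rcons big_cons. Qed.

(** The sign comes from the column of Q, last among the points but placed before the right half by
    [cols]: it crosses m columns. *)
Lemma Alt_row_word v d : (0 < m)%N -> size d = m ->
  Alt (row_word^~ d) v
  = (-1) ^+ m *: rows_word m (col_word v) (unzip1 d) (unzip2 d).
Proof.
move=> m_gt0 szd; rewrite /rows_word /cols map_rcons -!cats1 -!catA.
set C1 := map _ _; set g1 := map _ _; set C2 := map (map negb) _; set g2 := map negb _.
have szC1 : size C1 = m.-1 by rewrite size_map size_iota.
have szC2 : size C2 = m.-1 by rewrite !size_map size_iota.
have := @alternating_move _ _ _ _ _ (col_word_alternating v) C1 g1 (C2 ++ [:: g2]) [::].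
rewrite cats0 => ->; last by rewrite /= !size_cat /= size_cat szC1 szC2 /=; lia.
rewrite size_cat szC2 addn1 prednK // scalerA -expr2 sqrr_sign scale1r -catA.
apply: eq_Alt => w; pose e0 : (nat * bool) * (nat * bool) := (0%N, false, (0%N, false)).
rewrite /row_word -[in LHS](mkseq_nth e0 d) szd /mkseq -map_rev big_map.
apply: eq_big_seq => t; rewrite mem_rev mem_iota => /andP[_ tm].
apply: eq_minor_letter => j; rewrite mem_iota => /andP[j0 jm].
have td : (t < size d)%N by rewrite szd.
rewrite /row_of /row_pred !nth_cat szC1 szC2.
have [jlt|jge] := ltnP j m.
  rewrite (_ : j.-1 < m.-1)%N; last by lia.
  rewrite (nth_map 0%N) ?size_iota; last by lia.
  rewrite -map_comp (nth_map e0) // nth_iota; last by lia.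
  by rewrite add1n prednK.
rewrite (_ : (j.-1 < m.-1)%N = false); last by lia.
have [jlt|jge2] := ltnP j (2 * m).-1.
  rewrite (_ : j.-1 - m.-1 < m.-1)%N; last by lia.
  rewrite (nth_map [::]) ?size_map ?size_iota; last by lia.
  rewrite (nth_map 0%N) ?size_iota; last by lia.
  rewrite -!map_comp (nth_map e0) //= nth_iota; last by lia.
  by congr (~~ (_ < _)%N); lia.
rewrite (_ : (j.-1 - m.-1 < m.-1)%N = false); last by lia.
case: eqP => [jE|/eqP jN].
  rewrite (_ : j.-1 - m.-1 - m.-1 = 0)%N /=; last by lia.
  by rewrite /g2 -!map_comp (nth_map e0).
rewrite (_ : j.-1 - m.-1 - m.-1 = 1)%N /=; last by lia.
by rewrite /g1 -!map_comp (nth_map e0).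
Qed.

(** The staircase is read backwards: the point j has column 2m - j and the minor k has row m - k.
    Reversing 2m columns costs (-1)^(m(2m - 1)) = (-1)^m. *)
Lemma Alt_minors v : (0 < m)%N ->
  Alt (fun w => \prod_(1 <= k < m.+1)
                  minor_letter w (fun j => (k <= j < k + m)%N)) v
  = (-1) ^+ m *: stair_word m (col_word v).
Proof.
move=> m_gt0; rewrite /stair_word.
set S := _ ++ _.
have szS : size S = (2 * m)%N by rewrite size_cat !size_map !size_iota; lia.
have := @alternating_rev _ _ _ _ _ (col_word_alternating v) [::] S szS.
have -> : (-1) ^+ 'C(size S, 2) = (-1) ^+ m :> rat.
  rewrite szS -signr_odd -[RHS]signr_odd bin2 -mulnA mul2n doubleK oddM.
  have -> : odd (2 * m).-1 by lia.
  by rewrite andbT.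
move=> /= <-; apply: eq_Alt => w.
have -> : rev (iota 0 m) = [seq m - k | k <- iota 1 m]%N.
  apply: (@eq_from_nth _ 0%N) => [|i]; first by rewrite size_rev size_map !size_iota.
  rewrite size_rev size_iota => im.
  rewrite nth_rev ?size_iota // nth_iota; last by lia.
  by rewrite (nth_map 0%N) ?size_iota // nth_iota.
rewrite big_map /index_iota subSS subn0; apply: eq_big_seq => k.
rewrite mem_iota => /andP[k0 km]; apply: eq_minor_letter => j.
rewrite mem_iota => /andP[j0 jm]; rewrite /row_pred nth_rev ?szS; last by lia.
rewrite nth_cat size_map size_iota; case: (ltnP (2 * m - j.-1.+1) m.+1) => jc.
  by rewrite (nth_map 0%N) ?size_iota // nth_iota // nth_mkseq; lia.
rewrite (nth_map [::]) ?size_map ?size_iota; last by lia.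
rewrite (nth_map 0%N) ?size_iota; last by lia.
rewrite nth_iota; last by lia.
by rewrite (nth_map false) ?size_mkseq ?nth_mkseq; lia.
Qed.

End Columns.

(** * The letters of the symbol *)

Lemma det_mx22 (R : comNzRingType) (A : 'M[R]_2) :
  \det A = A ord0 ord0 * A ord_max ord_max - A ord0 ord_max * A ord_max ord0.
Proof.
rewrite (expand_det_row _ ord0) !big_ord_recl big_ord0 /cofactor !det_mx11 !mxE.
rewrite (_ : lift ord0 0 = ord_max); last exact: val_inj.
rewrite (_ : lift ord_max 0 = ord0); last exact: val_inj.
by rewrite /= expr0 expr1 mul1r mulN1r addr0 mulrN.
Qed.

Section Plucker.

Variables (K : fieldType) (n : nat) (N : 'M[K]_(2 + n, n)).

Definition cdet (x y : 'cV[K]_(2 + n)) : K := \det (row_mx (row_mx x y) N : 'M_(2 + n)).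

(* Multiplying by the inverse of [(p, q, N)] reduces the relation to its
   2 x 2 instance, which is a polynomial identity. *)
Lemma plucker a b p q : cdet p q != 0 ->
  cdet a p * cdet b q - cdet b p * cdet a q = cdet a b * cdet p q.
Proof.
move=> pq0; set B : 'M_(2 + n) := row_mx (row_mx p q) N.
have Bu : B \in unitmx by rewrite unitmxE unitfE.
pose u (x : 'cV[K]_(2 + n)) i : K := (invmx B *m x) (lshift n i) 0.
have cdetE x y : cdet x y
    = cdet p q * (u x ord0 * u y ord_max - u y ord0 * u x ord_max).
  (* In the basis of the columns of [B] the matrix becomes block triangular, and its 2 x 2 corner
     holds the coordinates of x and y along p and q. *)
  pose X : 'M[K]_(2 + n, 2) := invmx B *m row_mx x y.
  have -> : cdet x y = \det (B *m (row_mx X (col_mx 0 1%:M) : 'M_(2 + n))).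
    rewrite mul_mx_row /X mulKVmx // /B mul_row_col mulmx0 add0r mulmx1.
    by [].
  rewrite det_mulmx; congr (_ * _).
  rewrite -[X]vsubmxK -/(block_mx _ _ _ _) -block_mxEh det_lblock det1 mulr1.
  have uxE i : X (lshift n i) ord0 = u x i.
    rewrite /X /u mxE [RHS]mxE; apply: eq_bigr => k _; congr (_ * _).
    by rewrite -(row_mxEl x y); congr (row_mx x y k _); apply: val_inj.
  have uyE i : X (lshift n i) ord_max = u y i.
    rewrite /X /u mxE [RHS]mxE; apply: eq_bigr => k _; congr (_ * _).
    by rewrite -(row_mxEr x y); congr (row_mx x y k _); apply: val_inj.
  have XE i j : usubmx X i j = X (lshift n i) j by rewrite mxE.
  by rewrite det_mx22 !XE !uxE !uyE.
have d1 : u p ord0 * u q ord_max - u q ord0 * u p ord_max = 1.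
  by apply: (mulfI pq0); rewrite mulr1 -cdetE.
rewrite (cdetE a p) (cdetE b q) (cdetE b p) (cdetE a q) (cdetE a b).
suff relE (a0 a1 b0 b1 p0 p1 q0 q1 d : K) : p0 * q1 - q0 * p1 = 1 ->
    d * (a0 * p1 - p0 * a1) * (d * (b0 * q1 - q0 * b1))
    - d * (b0 * p1 - p0 * b1) * (d * (a0 * q1 - q0 * a1))
    = d * (a0 * b1 - b0 * a1) * d by exact: relE.
(* Inserting the factor p0 q1 - q0 p1 = 1 on the right makes this a polynomial identity. *)
by move=> pq1; rewrite -[RHS]mulr1 -pq1; ring.
Qed.

End Plucker.

Section Letters.

Variables (K : fieldType) (m : nat).
Hypothesis m_ge2 : (2 <= m)%N.
Implicit Types w : (2 * m).-tuple 'cV[K]_m.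

Lemma bracket_plucker (v : seq 'cV[K]_m) (x y p q : nat) (M : seq nat) :
    size M = m.-2 -> bracket v (p :: q :: M) != 0 ->
  bracket v (x :: p :: M) * bracket v (y :: q :: M)
    - bracket v (y :: p :: M) * bracket v (x :: q :: M)
  = bracket v (x :: y :: M) * bracket v (p :: q :: M).
Proof.
move: m m_ge2 v => [|[|n]] // _ v szM.
pose c j := nth 0 v j.-1 : 'cV[K]_(2 + n).
pose N : 'M[K]_(2 + n, n) := \matrix_(i, j) c (nth 0%N M j) i 0.
have bE a b : bracket v (a :: b :: M) = cdet N (c a) (c b).
  rewrite /bracket /cdet; congr (\det _); apply/matrixP => i j; rewrite !mxE.
  case: splitP => [k jk|k jk]; rewrite !mxE.
    case: splitP => [l kl|l kl]; rewrite /c jk kl !ord1 //=.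
  by rewrite /c jk.
by rewrite !bE => /plucker->.
Qed.

Lemma bracket_move1 (v : seq 'cV[K]_m) x p M : size M = m.-2 ->
  bracket v (x :: p :: M) = (-1) ^+ m * bracket v (x :: rcons M p).
Proof.
move=> szM.
have := @alternating_move _ _ _ _ _ (@bracket_alternating K m v) [:: x] p M [::].
rewrite cats0 cats1 => ->; last by rewrite /= szM; lia.
rewrite szM; congr (_ * _).
by rewrite -signr_odd -[RHS]signr_odd; congr (_ ^+ nat_of_bool _); lia.
Qed.

Lemma bracket_move2 (v : seq 'cV[K]_m) y p M : size M = m.-2 ->
  bracket v (y :: p :: M) = bracket v (rcons (rcons M y) p).
Proof.
move=> szM; have -> : rcons (rcons M y) p = M ++ [:: y; p].
  by rewrite -!cats1 -catA.
rewrite bracket_move1 // -cats1.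
have := @alternating_move _ _ _ _ _ (@bracket_alternating K m v) [::] y M [:: p].
rewrite /= => ->; last by rewrite /= size_cat szM /=; lia.
rewrite szM -[(-1) ^+ m.-2 *: _]/((-1) ^+ m.-2 * _) mulrA -exprD.
rewrite -signr_odd (_ : odd _ = false) ?mul1r //.
by lia.
Qed.

Definition minor w i b i' c := minor_letter w (row_of m (entry i b, entry i' c)).

Lemma row_ofE b c i i' j :
  row_of m (entry i b, entry i' c) j =
  [|| (j < m) && ((i + b).-1 < j), (m <= j < (2 * m).-1) && (j - m.-1 <= (i' + c).-1),
      (j == (2 * m).-1) && ~~ c | ((2 * m).-1 < j) && b]%N.
Proof. by rewrite /row_of /=; do !case: ifP => ?; case: b; case: c; lia. Qed.

Lemma letter_minor w x y M P : generic_position w -> size M = m.-2 ->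
    uniq (x :: y :: M) ->
    (forall j, (j \in x :: y :: M) = (0 < j <= 2 * m)%N && P j) ->
  bracket w (x :: y :: M) != 0
  /\ teq (letter (bracket w (x :: y :: M))) (minor_letter w P).
Proof.
move=> gw szM us sP; have szs : size (x :: y :: M) = m by rewrite /= szM; lia.
split; last exact: letter_bracketE.
by apply: bracket_neq0 => // j; rewrite sP => /andP[].
Qed.

Let p := (2 * m - 1)%N.
Let q := (2 * m)%N.

(** This and the next five lemmas translate brackets into minors. All share the run M from l + 1 to
    l + m - 2; the other two points form the six pairs among x = l, y = l + m - 1, P and Q. *)
Lemma bracket_p w l : generic_position w -> (0 < l <= m)%N ->
  let M := iota l.+1 m.-2 in
  bracket w (l :: p :: M) != 0
  /\ teq (letter (bracket w (l :: p :: M))) (minor w l false l false).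
Proof.
move=> gw lm; apply: letter_minor => //=; first by rewrite size_iota.
  by rewrite !inE !mem_iota iota_uniq /p; lia.
by move=> j; rewrite !inE mem_iota row_ofE /p; lia.
Qed.

Lemma bracket_q w l : generic_position w -> (0 < l <= m)%N ->
  let M := iota l.+1 m.-2 in
  bracket w (l :: q :: M) != 0
  /\ teq (letter (bracket w (l :: q :: M))) (minor w l.-1 true l.-1 true).
Proof.
move=> gw lm; apply: letter_minor => //=; first by rewrite size_iota.
  by rewrite !inE !mem_iota iota_uniq /q; lia.
by move=> j; rewrite !inE mem_iota row_ofE /q; lia.
Qed.

Lemma bracket_p' w l : generic_position w -> (0 < l < m)%N ->
  let M := iota l.+1 m.-2 in
  bracket w ((l + m.-1)%N :: p :: M) != 0
  /\ teq (letter (bracket w ((l + m.-1)%N :: p :: M))) (minor w l.+1 false l.+1 false).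
Proof.
move=> gw lm; apply: letter_minor => //=; first by rewrite size_iota.
  by rewrite !inE !mem_iota iota_uniq /p; lia.
by move=> j; rewrite !inE mem_iota row_ofE /p; lia.
Qed.

Lemma bracket_q' w l : generic_position w -> (0 < l < m)%N ->
  let M := iota l.+1 m.-2 in
  bracket w ((l + m.-1)%N :: q :: M) != 0
  /\ teq (letter (bracket w ((l + m.-1)%N :: q :: M))) (minor w l true l true).
Proof.
move=> gw lm; apply: letter_minor => //=; first by rewrite size_iota.
  by rewrite !inE !mem_iota iota_uniq /q; lia.
by move=> j; rewrite !inE mem_iota row_ofE /q; lia.
Qed.

Lemma bracket_xy w l : generic_position w -> (0 < l < m)%N ->
  let M := iota l.+1 m.-2 in
  bracket w (l :: (l + m.-1)%N :: M) != 0
  /\ teq (letter (bracket w (l :: (l + m.-1)%N :: M))) (minor w l false l true).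
Proof.
move=> gw lm; apply: letter_minor => //=; first by rewrite size_iota.
  by rewrite !inE !mem_iota iota_uniq; lia.
by move=> j; rewrite !inE mem_iota row_ofE; lia.
Qed.

Lemma bracket_pq w l : generic_position w -> (0 < l < m)%N ->
  let M := iota l.+1 m.-2 in
  bracket w (p :: q :: M) != 0
  /\ teq (letter (bracket w (p :: q :: M))) (minor w l true l false).
Proof.
move=> gw lm; apply: letter_minor => //=; first by rewrite size_iota.
  by rewrite !inE !mem_iota iota_uniq /p /q; lia.
by move=> j; rewrite !inE mem_iota row_ofE /p /q; lia.
Qed.

Lemma rhoE w l : rho w l = bracket w (l :: p :: iota l.+1 m.-2)
                           / bracket w (l :: q :: iota l.+1 m.-2).
Proof.
have iotaE : iota l m.-1 = l :: iota l.+1 m.-2.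
  by rewrite (_ : m.-1 = m.-2.+1)%N //; lia.
rewrite /rho iotaE !bracket_move1 ?size_iota // -mulf_div divff ?signr_eq0 //.
by rewrite mul1r.
Qed.

(** Moving y to the front exhibits rho_(l+1) over the same run M as rho_l, as the Pluecker relation
    needs. *)
Lemma rhoSE w l : rho w l.+1 = bracket w ((l + m.-1)%N :: p :: iota l.+1 m.-2)
                           / bracket w ((l + m.-1)%N :: q :: iota l.+1 m.-2).
Proof.
rewrite /rho !bracket_move2 ?size_iota //.
have -> : iota l.+1 m.-1 = rcons (iota l.+1 m.-2) (l + m.-1)%N; last by [].
have m1 : m.-1 = m.-2.+1 by lia.
by rewrite m1; move: m.-2 => n; rewrite -cats1 addnS -addSn -(iotaD _ n 1) addn1.
Qed.

Lemma letter_rho w l : generic_position w -> (0 < l <= m)%N ->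
  rho w l != 0
  /\ teq (letter (rho w l)) (minor w l false l false - minor w l.-1 true l.-1 true).
Proof.
move=> gw lm; have [p0 pE] := bracket_p gw lm; have [q0 qE] := bracket_q gw lm.
rewrite rhoE; split; first by rewrite mulf_neq0 ?invr_eq0.
by apply: teq_trans (letter_div p0 q0) _; apply: teqB.
Qed.

(** The Pluecker relation turns the difference into the single quotient <x y M><P Q M> / (<y Q M><x
    Q M>). *)
Lemma letter_rhoB w l : generic_position w -> (0 < l < m)%N ->
  rho w l - rho w l.+1 != 0
  /\ teq (letter (rho w l - rho w l.+1))
       (minor w l false l true + minor w l true l false
        - minor w l true l true - minor w l.-1 true l.-1 true).
Proof.
move=> gw lm; have lm' : (0 < l <= m)%N by lia.
have [xq0 xqE] := bracket_q gw lm'; have [yq0 yqE] := bracket_q' gw lm.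
have [xy0 xyE] := bracket_xy gw lm; have [pq0 pqE] := bracket_pq gw lm.
have -> : rho w l - rho w l.+1
    = (bracket w (l :: (l + m.-1)%N :: iota l.+1 m.-2)
       * bracket w (p :: q :: iota l.+1 m.-2))
      / (bracket w ((l + m.-1)%N :: q :: iota l.+1 m.-2)
         * bracket w (l :: q :: iota l.+1 m.-2)).
  rewrite rhoE rhoSE -bracket_plucker ?size_iota // -mulNr addf_div //.
  by rewrite mulNr; congr (_ / _); rewrite mulrC.
split; first by rewrite mulf_neq0 ?invr_eq0 ?mulf_neq0.
apply: teq_trans (letter_div _ _) _; try by rewrite mulf_neq0.
rewrite -[X in teq _ X]addrA -opprD.
apply: teqB; apply: teq_trans (letterM _ _) _; by [|apply: teqD].
Qed.

End Letters.

(** * Symmetric deletions *)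

Lemma symbol_recS (K : fieldType) N (x : nat -> K) :
  symbol_rec N.+1 x =
  \sum_(1 <= i < N.+2)
    symbol_rec N (x \o bump i) * letter (ell (x i.-1) (x i) (x i.+1)).
Proof. by []. Qed.

Lemma eq_symbol_rec (K : fieldType) N (x y : nat -> K) :
  (forall i, (i <= N.+1)%N -> x i = y i) -> symbol_rec N x = symbol_rec N y.
Proof.
elim: N x y => [//|N IH] x y xy; apply: eq_big_nat => i /andP[i0 iN].
rewrite !xy; try lia; congr (_ * _); apply: IH => j jN /=.
by apply: xy; rewrite /bump; case: leqP; lia.
Qed.

Section AdjacentSwaps.

Variables (K : fieldType) (m : nat).
Hypothesis m_ge2 : (2 <= m)%N.
Implicit Types w v : (2 * m).-tuple 'cV[K]_m.

Definition swapn i j : nat :=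
  if j == i then i.+1 else if j == i.+1 then i else j.

Definition adjacent_swap i (t : 'S_(2 * m)) : Prop :=
  forall o : 'I_(2 * m), (t o).+1 = swapn i o.+1.

Lemma Alt_adjacent_swap i (f : (2 * m).-tuple 'cV[K]_m -> words K) v :
    (0 < i < 2 * m)%N ->
    (forall t w, adjacent_swap i t -> f (permt t w) = f w) ->
  Alt f v = 0.
Proof.
move=> im ft; have i1 : (i.-1 < 2 * m)%N by lia.
have i2 : (i < 2 * m)%N by lia.
apply: (@Alt_symmetric _ _ _ (Ordinal i1) (Ordinal i2)).
  by rewrite -val_eqE /=; lia.
move=> w; apply: ft => o; rewrite /swapn; case: tpermP => [->|->|] /=.
- by case: eqP; lia.
- by do !case: eqP; lia.
by move=> /eqP o1 /eqP o2; move: o1 o2; rewrite -!val_eqE /=; do !case: eqP; lia.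
Qed.

Lemma minor_letter_swap i t w P : adjacent_swap i t -> P i = P i.+1 ->
  minor_letter (permt t w) P = minor_letter w P.
Proof.
move=> ti Pi; apply: minor_letter_permt => o; rewrite ti /swapn.
by case: eqP => [->|_] //; case: eqP => [->|].
Qed.

Lemma bracket_swap i t w s : adjacent_swap i t -> size s = m ->
    (forall j, j \in s -> 0 < j <= 2 * m)%N ->
  bracket (permt t w) s = bracket w (map (swapn i) s).
Proof.
move=> ti szs sP; rewrite /bracket; congr (\det _); apply/matrixP => a b.
rewrite !mxE (nth_map 0%N) ?szs //.
have sb : (0 < nth 0%N s b <= 2 * m)%N by apply/sP/mem_nth; rewrite szs.
have lt : ((nth 0%N s b).-1 < 2 * m)%N by lia.
rewrite -[(nth 0%N s b).-1]/(val (Ordinal lt)) -(tnth_nth 0 (permt t w)).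
rewrite tnth_mktuple (tnth_nth 0); congr (fun_of_matrix (nth _ _ _) _ _).
by have := ti (Ordinal lt); rewrite /= prednK => [<-|]; lia.
Qed.

Lemma bracket_swap_iota i t w j x : adjacent_swap i t ->
    (0 < j <= m)%N -> (i.+1 < x <= 2 * m)%N -> (j + m.-1 <= x)%N ->
    j != i.+1 -> (j + m.-2)%N != i ->
  bracket (permt t w) (rcons (iota j m.-1) x)
  = (-1) ^+ (j <= i < j + m.-2)%N * bracket w (rcons (iota j m.-1) x).
Proof.
move=> ti jm ix jx ji1 ji2; rewrite (@bracket_swap i) //; first last.
- by move=> a; rewrite mem_rcons inE mem_iota; lia.
- by rewrite size_rcons size_iota; lia.
have sx : swapn i x = x by rewrite /swapn; do !case: eqP; lia.
have si : swapn i i = i.+1 by rewrite /swapn eqxx.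
have si1 : swapn i i.+1 = i by rewrite /swapn; do !case: eqP; lia.
rewrite map_rcons sx.
case: (boolP (j <= i < j + m.-2)%N) => iP; last first.
  rewrite mul1r; congr (bracket _ (rcons _ _)); rewrite -[RHS]map_id.
  apply/eq_in_map => a; rewrite mem_iota /swapn => aP.
  by do !case: eqP; lia.
have -> : iota j m.-1 = iota j (i - j) ++ i :: i.+1 :: iota i.+2 (j + m.-1 - i.+2).
  rewrite (_ : m.-1 = (i - j) + (j + m.-1 - i.+2).+2)%N; last by lia.
  rewrite iotaD (_ : j + (i - j) = i)%N /=; last by lia.
  by congr (_ ++ _ :: _ :: iota _ _); lia.
rewrite map_cat /= si si1.
have swapnK a n : (a + n <= i \/ i.+1 < a)%N -> map (swapn i) (iota a n) = iota a n.
  move=> an; rewrite -[RHS]map_id; apply/eq_in_map => b; rewrite mem_iota /swapn => bP.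
  by do !case: eqP; lia.
rewrite !swapnK; try lia.
rewrite expr1 mulN1r -!cats1 -!catA /=.
have := @bracket_alternating K m w (iota j (i - j)) i.+1 i.
by move=> ->; rewrite // size_cat !size_iota /=; lia.
Qed.

(** The run j, ..., j + m - 2 contains both or neither of i and i + 1, so numerator and denominator
    change by the same sign. *)
Lemma rho_swap i t w j : adjacent_swap i t -> (i.+1 < (2 * m).-1)%N ->
    (0 < j <= m)%N -> j != i.+1 -> (j + m.-2)%N != i ->
  rho (permt t w) j = rho w j.
Proof.
move=> ti im jm ji1 ji2; rewrite /rho !(bracket_swap_iota _ ti) //; try lia.
by rewrite -mulf_div divff ?signr_eq0 // mul1r.
Qed.

Definition swap_invariant i (f : (2 * m).-tuple 'cV[K]_m -> words K) : Prop :=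
  forall t w, adjacent_swap i t -> f (permt t w) = f w.

Lemma minor_swap i i1 b i2 c :
    row_of m (entry i1 b, entry i2 c) i = row_of m (entry i1 b, entry i2 c) i.+1 ->
  swap_invariant i (fun w => minor w i1 b i2 c).
Proof. by move=> Pi t w ti; apply: (minor_letter_swap _ ti). Qed.

Lemma Alt_swap3 i S M E v : (0 < i < 2 * m)%N ->
    swap_invariant i S -> swap_invariant i M -> swap_invariant i E ->
  Alt (fun w => S w * M w * E w) v = 0.
Proof.
move=> im iS iM iE; apply: (@Alt_adjacent_swap i (fun w => S w * M w * E w) v im).
move=> t w ti.
by rewrite (iS _ _ ti) (iM _ _ ti) (iE _ _ ti).
Qed.

End AdjacentSwaps.

Lemma mul_sum3 (R : nzRingType) (s e a b c a' b' c' : R) :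
  s * ((a + b - c) - (a' + b' - c')) * e
  = (s * a * e + s * b * e - s * c * e) - (s * a' * e + s * b' * e - s * c' * e).
Proof. by rewrite !(mulrBr, mulrDr) !(mulrBl, mulrDl). Qed.

Lemma mul_sum4 (R : nzRingType) (s e a b c d : R) :
  s * (a + b - c - d) * e
  = s * (a * e) + s * (b * e) - s * (c * e) - s * (d * e).
Proof. by rewrite !(mulrBr, mulrDr) !(mulrBl, mulrDl) !mulrA. Qed.

Lemma mul_sum2 (R : nzRingType) (s e a b : R) :
  s * (a - b) * e = s * (a * e) - s * (b * e).
Proof. by rewrite mulrBr mulrBl !mulrA. Qed.

(** * The recursion for the symbol under alternation *)

Section Recursion.

Variables (K : fieldType) (m : nat).
Hypothesis m_ge2 : (2 <= m)%N.
Implicit Types w v : (2 * m).-tuple 'cV[K]_m.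

Lemma letter_ell_00 w k : generic_position w -> (0 < k <= m)%N ->
  teq (letter (ell 0 0 (rho w k)))
      (minor w k false k false - minor w k.-1 true k.-1 true).
Proof.
move=> gw km; have [r0 rE] := letter_rho m_ge2 gw km.
rewrite /ell eqxx eq_sym (negPf r0) sub0r.
exact: teq_trans (letterN r0) rE.
Qed.

Lemma teq_subr (a b c d e : words K) :
  teq a (b - d) -> teq c (e - d) -> teq (a - c) (b - e).
Proof.
move=> ab ce; apply: teq_trans (teqB ab ce) _.
by apply: teq_eq; rewrite opprB addrA subrK.
Qed.

(** This letter is a_k. The bracket of x, M and Q cancels between the difference and rho_k, leaving
    one minor for each pair of bits (b, c), with sign -(-1)^(b + c). *)
Lemma letter_ell_0 w k : generic_position w -> (0 < k < m)%N ->
  teq (letter (ell 0 (rho w k) (rho w k.+1)))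
      (minor w k false k true + minor w k true k false
       - minor w k true k true - minor w k false k false).
Proof.
move=> gw km; have km' : (0 < k <= m)%N by lia.
have [r0 rE] := letter_rho m_ge2 gw km'.
have [d0 dE] := letter_rhoB m_ge2 gw km.
rewrite /ell eq_sym (negPf r0) -subr_eq0 (negPf d0) subr0.
apply: teq_trans (letter_div d0 r0) _; exact: teq_subr dE rE.
Qed.

(** The quotient cancels [minor w l true l true], the only bracket involved that is symmetric in
    neither of the pairs (l, l + 1) and (l + m - 1, l + m). *)
Lemma letter_ell_mid w l : generic_position w -> (0 < l)%N -> (l.+1 < m)%N ->
  teq (letter (ell (rho w l) (rho w l.+1) (rho w l.+2)))
      ((minor w l.+1 false l.+1 true + minor w l.+1 true l.+1 false
        - minor w l.+1 true l.+1 true)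
       - (minor w l false l true + minor w l true l false
          - minor w l.-1 true l.-1 true)).
Proof.
move=> gw l0 lm; have l1 : (0 < l < m)%N by lia.
have l2 : (0 < l.+1 < m)%N by lia.
have [d0 dE] := letter_rhoB m_ge2 gw l1.
have [e0 eE] := letter_rhoB m_ge2 gw l2.
rewrite /ell -subr_eq0 (negPf d0) -subr_eq0 (negPf e0).
have d0' : rho w l.+1 - rho w l != 0 by rewrite -opprB oppr_eq0.
apply: teq_trans (letter_div e0 d0') _; apply: (teq_subr eE).
apply: teq_trans (teq_sym (letterN d0')) _; rewrite opprB addrAC; exact: dE.
Qed.

Lemma Alt_sum3 S (M1 M2 M3 M4 M5 M6 E : (2 * m).-tuple 'cV[K]_m -> words K) v :
  Alt (fun w => S w * ((M1 w + M2 w - M3 w) - (M4 w + M5 w - M6 w)) * E w) v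
  = (Alt (fun w => S w * M1 w * E w) v + Alt (fun w => S w * M2 w * E w) v
     - Alt (fun w => S w * M3 w * E w) v)
    - (Alt (fun w => S w * M4 w * E w) v + Alt (fun w => S w * M5 w * E w) v
     - Alt (fun w => S w * M6 w * E w) v).
Proof.
transitivity (Alt (fun w =>
    (S w * M1 w * E w + S w * M2 w * E w - S w * M3 w * E w)
    - (S w * M4 w * E w + S w * M5 w * E w - S w * M6 w * E w)) v); last first.
  by do 2![rewrite AltB; congr (_ - _)]; rewrite ?AltB AltD.
apply: eq_Alt => w; move: (S w) (E w) (M1 w) (M2 w) (M3 w) (M4 w) (M5 w) (M6 w).
by move=> *; apply: mul_sum3.
Qed.

(* Deleting [rho_(l+1)] leaves an expression symmetric in the labels l, l+1 and
   in the labels l+m-1, l+m, and each of the brackets making up the remaining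
   letter is symmetric in one of these two pairs. *)
Lemma Alt_deletion l S (E : (2 * m).-tuple 'cV[K]_m -> words K) v :
    generic_position v -> (0 < l)%N -> (l.+1 < m)%N ->
    swap_invariant l S -> swap_invariant (l + m.-1) S ->
    swap_invariant l E -> swap_invariant (l + m.-1) E ->
  teq (Alt (fun w => S w * letter (ell (rho w l) (rho w l.+1) (rho w l.+2)) * E w) v) 0.
Proof.
move=> gv l0 lm S1 S2 E1 E2.
apply: (teq_trans (t := Alt (fun w =>
   S w * ((minor w l.+1 false l.+1 true + minor w l.+1 true l.+1 false
           - minor w l.+1 true l.+1 true)
          - (minor w l false l true + minor w l true l false
             - minor w l.-1 true l.-1 true)) * E w) v)).
  apply: teq_Alt => s; apply: teqM; last exact: teq_refl.
  apply: teqM; first exact: teq_refl.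
  by apply: letter_ell_mid => //; apply: generic_position_permt.
rewrite Alt_sum3; apply: teq_eq.
have i1 : (0 < l < 2 * m)%N by lia.
have i2 : (0 < l + m.-1 < 2 * m)%N by lia.
have Z1 b c i : row_of m (entry i b, entry i c) l = row_of m (entry i b, entry i c) l.+1 ->
    Alt (fun w => S w * minor w i b i c * E w) v = 0.
  by move=> H; apply: (Alt_swap3 m_ge2 v i1 S1 (minor_swap (K := K) H) E1).
have Z2 b c i : row_of m (entry i b, entry i c) (l + m.-1)
              = row_of m (entry i b, entry i c) (l + m.-1).+1 ->
    Alt (fun w => S w * minor w i b i c * E w) v = 0.
  by move=> H; apply: (Alt_swap3 m_ge2 v i2 S2 (minor_swap (K := K) H) E2).
have zeroE (a b c a' b' c' : words K) : a = 0 -> b = 0 -> c = 0 ->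
    a' = 0 -> b' = 0 -> c' = 0 -> (a + b - c) - (a' + b' - c') = 0.
  by move=> -> -> -> -> -> ->; rewrite addr0 !subr0.
apply: zeroE.
- by apply: (Z2 false true l.+1); rewrite !row_ofE //; lia.
- by apply: (Z1 true false l.+1); rewrite !row_ofE //; lia.
- by apply: (Z1 true true l.+1); rewrite !row_ofE //; lia.
- by apply: (Z1 false true l); rewrite !row_ofE //; lia.
- by apply: (Z2 true false l); rewrite !row_ofE //; lia.
- by apply: (Z1 true true l.-1); rewrite !row_ofE //; lia.
Qed.

Definition rows_below k (d : seq ((nat * bool) * (nat * bool))) : bool :=
  all (fun e => (e.1.1 < k) && (e.2.1 < k))%N d.

(** With thresholds below k, each row contains all points from k to m - 1 and none from k + m - 1 to
    2m - 2, so it does not separate adjacent ones. *)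
Lemma row_word_swap i k d : (0 < k)%N -> rows_below k d ->
    (k <= i)%N && (i.+1 < m)%N || (k + m.-1 <= i)%N && (i.+1 < (2 * m).-1)%N ->
  swap_invariant i (fun w => row_word w d).
Proof.
move=> k0 /allP dk iP t w ti; apply: eq_big_seq => e; rewrite mem_rev => /dk/andP[e1 e2].
apply: (minor_letter_swap _ ti); rewrite /row_of.
case/orP: iP => /andP[i1 i2].
  by rewrite i2 (ltn_trans _ i2) //; lia.
rewrite (_ : (i < m)%N = false); last by lia.
rewrite (_ : (i.+1 < m)%N = false); last by lia.
by rewrite i2 (ltn_trans _ i2) //; lia.
Qed.

(* The sequences 0, rho_k, ..., rho_m and 0, 0, rho_k, ..., rho_m for [c = 1]
   and [c = 2]. *)
Definition zrho c w k i : K := if (i < c)%N then 0 else rho w (k + i - c).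

(** A state of the recursion: the symbol of the remaining sequence, then on the right the letters
    [d] already split off. The length m - k + c - 1 counts the entries between the two end
    points. *)
Definition zword c v k d : words K :=
  Alt (fun w => symbol_rec (m - k + c.-1) (zrho c w k) * row_word w d) v.

Lemma Alt_expand4 k S d v :
  Alt (fun w => S w * (minor w k false k true + minor w k true k false
       - minor w k true k true - minor w k false k false) * row_word w d) v
  = Alt (fun w => S w * row_word w (rcons d (entry k false, entry k true))) v
    + Alt (fun w => S w * row_word w (rcons d (entry k true, entry k false))) v
    - Alt (fun w => S w * row_word w (rcons d (entry k true, entry k true))) v
    - Alt (fun w => S w * row_word w (rcons d (entry k false, entry k false))) v.
Proof.
transitivity (Alt (fun w =>
    S w * row_word w (rcons d (entry k false, entry k true))
    + S w * row_word w (rcons d (entry k true, entry k false))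
    - S w * row_word w (rcons d (entry k true, entry k true))
    - S w * row_word w (rcons d (entry k false, entry k false))) v); last first.
  by do 2![rewrite AltB; congr (_ - _)]; rewrite AltD.
apply: eq_Alt => w; rewrite !row_word_rcons /minor.
move: (S w) (row_word w d) (minor_letter _ _) (minor_letter _ _).
move: (minor_letter _ _) (minor_letter _ _).
by move=> *; apply: mul_sum4.
Qed.

Lemma zrho_ge c w k j : (c <= j)%N -> zrho c w k j = rho w (k + j - c).
Proof. by rewrite /zrho ltnNge => ->. Qed.

(** Past position [c] the deleted entry and both its neighbours are values of rho, so [Alt_deletion]
    applies. *)
Lemma Alt_zrho_deletion v c k d i n : generic_position v -> (0 < k)%N -> rows_below k d ->
    (m - k + c.-1 = n.+1)%N -> (0 < c < i)%N -> (i < n.+2)%N ->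
  teq (Alt (fun w => symbol_rec n (zrho c w k \o bump i)
         * letter (ell (zrho c w k i.-1) (zrho c w k i) (zrho c w k i.+1))
         * row_word w d) v) 0.
Proof.
move=> gv k0 dk nE ci iP; pose l := (k + i.-1 - c)%N.
have ellE w : ell (zrho c w k i.-1) (zrho c w k i) (zrho c w k i.+1)
    = ell (rho w l) (rho w l.+1) (rho w l.+2).
  rewrite !zrho_ge; try lia.
  rewrite (_ : k + i - c = l.+1)%N; last by rewrite /l; lia.
  by rewrite (_ : k + i.+1 - c = l.+2)%N; last by rewrite /l; lia.
pose S w := symbol_rec n (zrho c w k \o bump i).
apply: (teq_trans (t := Alt (fun w => S w
   * letter (ell (rho w l) (rho w l.+1) (rho w l.+2)) * row_word w d) v)).
  by apply/teq_eq/eq_Alt => w; rewrite ellE.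
have Sinv a : (a == l) || (a == l + m.-1)%N -> swap_invariant a S.
  move=> aP t w ta; apply: eq_symbol_rec => j jn; rewrite /zrho /=.
  case: ltnP => // b0; apply: (rho_swap m_ge2 _ ta); move: b0 aP;
    by rewrite /bump /l; case: leqP; lia.
apply: (@Alt_deletion l S (fun w => row_word w d) v gv).
- by rewrite /l; lia.
- by rewrite /l; lia.
- by apply: Sinv; rewrite eqxx.
- by apply: Sinv; rewrite eqxx orbT.
- by apply: (@row_word_swap _ k); rewrite // /l; lia.
- by apply: (@row_word_swap _ k); rewrite // /l; lia.
Qed.

(** The bound [minn] covers the end of the recursion, where rho_m is the upper limit of integration
    and cannot be deleted. *)
Lemma zword_expand v c k d n : generic_position v -> (0 < k)%N -> rows_below k d ->
    (m - k + c.-1 = n.+1)%N -> (0 < c)%N ->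
  teq (zword c v k d)
    (\sum_(1 <= i < (minn c n.+1).+1)
       Alt (fun w => symbol_rec n (zrho c w k \o bump i)
         * letter (ell (zrho c w k i.-1) (zrho c w k i) (zrho c w k i.+1))
         * row_word w d) v).
Proof.
move=> gv k0 dk nE c0; rewrite /zword nE.
pose F i w := symbol_rec n (zrho c w k \o bump i)
   * letter (ell (zrho c w k i.-1) (zrho c w k i) (zrho c w k i.+1)) * row_word w d.
apply: (teq_trans (t := Alt (fun w => \sum_(1 <= i < n.+2) F i w) v)).
  by apply/teq_eq/eq_Alt => w; rewrite symbol_recS /F [LHS]mulr_suml.
apply: teq_trans (teq_eq (Alt_sum _ F v)) _.
rewrite (@big_cat_nat _ _ _ (minn c n.+1).+1) //=; last by rewrite ltnS geq_minr.
rewrite -[X in teq _ X]addr0; apply: teqD; first exact: teq_refl.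
apply: (teq_trans (t := \sum_((minn c n.+1).+1 <= i < n.+2) 0)); last first.
  by apply: teq_eq; apply: big1_eq.
apply: teq_sum_nat => i /andP[i0 i1]; apply: Alt_zrho_deletion => //.
by lia.
Qed.

Definition zword_next c v k d : words K :=
  zword c v k.+1 (rcons d (entry k false, entry k true))
  + zword c v k.+1 (rcons d (entry k true, entry k false))
  - zword c v k.+1 (rcons d (entry k true, entry k true))
  - zword c v k.+1 (rcons d (entry k false, entry k false)).

Lemma zword_delete_rho v c k d n : generic_position v -> (0 < k < m)%N ->
    (m - k + c.-1 = n.+1)%N -> (0 < c)%N ->
  teq (Alt (fun w => symbol_rec n (zrho c w k \o bump c)
         * letter (ell (zrho c w k c.-1) (zrho c w k c) (zrho c w k c.+1))
         * row_word w d) v)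
      (zword_next c v k d).
Proof.
move=> gv km nE c0; rewrite /zword_next /zword.
rewrite (_ : m - k.+1 + c.-1 = n)%N; last by lia.
apply: teq_trans (teq_eq (Alt_expand4 k (fun w => symbol_rec n (zrho c w k.+1)) d v)).
apply: teq_Alt => s; apply: teqM; last exact: teq_refl.
apply: teqM.
  apply/teq_eq/eq_symbol_rec => i _; rewrite /zrho /bump /=.
  by case: (leqP c i) => ci; [rewrite ltnNge leqW //=; congr rho; lia | rewrite ci].
rewrite {1}/zrho ltn_predL c0 !zrho_ge // addnK (_ : k + c.+1 - c = k.+1)%N; last by lia.
by apply: letter_ell_0 => //; apply: generic_position_permt.
Qed.

Lemma zword1_step v k d : generic_position v -> (0 < k < m)%N -> rows_below k d ->
  teq (zword 1 v k d) (zword_next 1 v k d).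
Proof.
move=> gv km dk; have k0 : (0 < k)%N by lia.
have nE : (m - k + 1.-1 = (m - k.+1).+1)%N by lia.
apply: teq_trans (zword_expand gv k0 dk nE _) _; first by [].
rewrite (minn_idPl _) // big_nat1.
exact: zword_delete_rho.
Qed.

(** Deleting the inner zero inserts the letter rho_k without advancing [k]; its numerator and
    denominator are rows whose bits b and c agree. *)
Definition zword_turn v k d : words K :=
  zword 1 v k (rcons d ((k.-1, false), (k.-1, false)))
  - zword 1 v k (rcons d ((k.-1, true), (k.-1, true))).

Lemma zword_delete_zero v k d n : generic_position v -> (0 < k <= m)%N ->
    (m - k = n)%N ->
  teq (Alt (fun w => symbol_rec n (zrho 2 w k \o bump 1)
         * letter (ell (zrho 2 w k 0) (zrho 2 w k 1) (zrho 2 w k 2))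
         * row_word w d) v)
      (zword_turn v k d).
Proof.
move=> gv km nE; rewrite /zword_turn /zword /= addn0 nE.
pose S w := symbol_rec n (zrho 1 w k).
apply: (teq_trans (t := Alt (fun w => S w * (minor w k false k false
                         - minor w k.-1 true k.-1 true) * row_word w d) v)).
  apply: teq_Alt => s; apply: teqM; last exact: teq_refl.
  apply: teqM.
    apply/teq_eq/eq_symbol_rec => -[|i] _ //=; rewrite /zrho /bump /=.
    by congr rho; lia.
  rewrite [zrho 2 _ k 2]zrho_ge // addnK.
  by apply: letter_ell_00 => //; apply: generic_position_permt.
apply: teq_eq; rewrite -/S.
transitivity (Alt (fun w => S w * row_word w (rcons d ((k.-1, false), (k.-1, false)))
                          - S w * row_word w (rcons d ((k.-1, true), (k.-1, true)))) v).
  apply: eq_Alt => w; rewrite !row_word_rcons /minor /entry addn0 addn1 prednK; last by lia.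
  exact: mul_sum2.
by rewrite AltB.
Qed.

Lemma zword2_step v k d : generic_position v -> (0 < k < m)%N -> rows_below k d ->
  teq (zword 2 v k d) (zword_turn v k d + zword_next 2 v k d).
Proof.
move=> gv km dk; have k0 : (0 < k)%N by lia.
have nE : (m - k + 2.-1 = (m - k).+1)%N by lia.
apply: teq_trans (zword_expand gv k0 dk nE _) _; first by [].
rewrite (minn_idPl _); last by lia.
rewrite big_ltn // big_nat1; apply: teqD.
  by apply: zword_delete_zero => //; lia.
exact: zword_delete_rho.
Qed.

Lemma zword2_last v d : generic_position v -> rows_below m d ->
  teq (zword 2 v m d) (zword_turn v m d).
Proof.
move=> gv dk; have k0 : (0 < m)%N by lia.
have nE : (m - m + 2.-1 = 0.+1)%N by lia.
apply: teq_trans (zword_expand gv k0 dk nE _) _; first by [].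
rewrite (minn_idPr _) // big_nat1.
by apply: zword_delete_zero; rewrite ?subnn ?k0 /=.
Qed.

End Recursion.

(** * Summation *)

Section RowSums.

Variable W : lmodType rat.

Lemma bsumZ n r (h : seq bool -> W) :
  bsum n (fun s => r *: h s) = r *: bsum n h.
Proof.
elim: n h => [//|n IH] h /=; rewrite scalerBr.
by rewrite -(IH (h \o cons false)) -(IH (h \o cons true)).
Qed.

Definition rows_bsum n k (F : seq ((nat * bool) * (nat * bool)) -> W) d : W :=
  bsum n (fun b => bsum n (fun c => F (d ++ zip (entries k b) (entries k c)))).

Lemma rows_bsum0 k F d : rows_bsum 0 k F d = F d.
Proof. by rewrite /rows_bsum /= cats0. Qed.

(** One more row reproduces the four terms of a letter a_k with the opposite sign, whence the powers
    of -1 in the closed forms below. *)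
Lemma rows_bsumS n k F d (X := fun b c =>
    rows_bsum n k.+1 F (rcons d (entry k b, entry k c))) :
  rows_bsum n.+1 k F d = - (X false true + X true false - X true true - X false false).
Proof.
have XE b0 : bsum n (fun b => bsum n.+1 (fun c =>
      F (d ++ zip (entries k (b0 :: b)) (entries k c)))) = X b0 false - X b0 true.
  rewrite /= bsumB; congr (_ - _); apply: eq_bsum => b _; apply: eq_bsum => c _;
    by rewrite /= cat_rcons.
rewrite /rows_bsum [LHS]/= -/(bsum n.+1).
transitivity ((X false false - X false true) - (X true false - X true true)).
  by rewrite -!XE.
rewrite !opprD !opprK; move: (X _ _) (X _ _) (X _ _) (X _ _) => a b c e.
by rewrite -!addrA addrC -!addrA.
Qed.

Lemma rows_bsumS_sign n k F d (X := fun b c =>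
    (-1) ^+ n *: rows_bsum n k.+1 F (rcons d (entry k b, entry k c))) :
  (-1) ^+ n.+1 *: rows_bsum n.+1 k F d
  = X false true + X true false - X true true - X false false.
Proof. by rewrite rows_bsumS scalerN -scaleNr exprS mulN1r opprK !scalerBr scalerDr. Qed.

Lemma scalerA_eq (a b c : rat) (x : W) : a * b = c -> a *: (b *: x) = c *: x.
Proof. by move=> <-; rewrite scalerA. Qed.

Lemma scalerA_eqN (a b c : rat) (x : W) : a * b = - c -> a *: (b *: x) = - (c *: x).
Proof. by move=> abc; rewrite scalerA abc scaleNr. Qed.

End RowSums.

(** * Closed forms of the recursion and comparison with the Grassmannian polylogarithm *)

Section Assembly.

Variables (K : fieldType) (m : nat).
Hypothesis m_ge2 : (2 <= m)%N.
Implicit Types (w v : (2 * m).-tuple 'cV[K]_m) (d : seq ((nat * bool) * (nat * bool))).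

Lemma rows_below_rcons k d i j b c :
  (i <= k)%N -> (j <= k)%N -> rows_below k d -> rows_below k.+1 (rcons d ((i, b), (j, c))).
Proof.
move=> ik jk /allP dk; rewrite /rows_below all_rcons /= !ltnS ik jk /=.
by apply/allP => e /dk /andP[e1 e2]; rewrite !ltnS (ltnW e1) (ltnW e2).
Qed.

Lemma rows_below_turn k d b c : (0 < k)%N -> rows_below k d ->
  rows_below k (rcons d ((k.-1, b), (k.-1, c))).
Proof. by move=> k0 dk; rewrite /rows_below all_rcons /= prednK // leqnn. Qed.

Lemma rows_below_next k d b c : (0 < k)%N -> rows_below k d ->
  rows_below k.+1 (rcons d (entry k b, entry k c)).
Proof. by move=> k0 dk; apply: rows_below_rcons dk; case: b c => -[]; lia. Qed.

Lemma zword1_sum v k d : generic_position v -> (0 < k <= m)%N -> rows_below k d ->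
  teq (zword 1 v k d)
      ((-1) ^+ (m - k) *: rows_bsum (m - k) k (fun d' => Alt (fun w => row_word w d') v) d).
Proof.
move=> gv; have [n nE] : exists n, (m - k = n)%N by exists (m - k)%N.
elim: n k d nE => [|n IH] k d nE kP dk.
  apply: teq_eq; rewrite nE rows_bsum0 expr0 scale1r /zword nE.
  by apply: eq_Alt => w; apply: mul1r.
have k0 : (0 < k < m)%N by lia.
apply: teq_trans (zword1_step m_ge2 gv k0 dk) _.
have nE' : (m - k.+1 = n)%N by lia.
rewrite nE rows_bsumS_sign.
have next b c : teq (zword 1 v k.+1 (rcons d (entry k b, entry k c)))
    ((-1) ^+ n *: rows_bsum n k.+1 (fun d' => Alt (fun w => row_word w d') v)
                   (rcons d (entry k b, entry k c))).
  rewrite -[in X in teq _ X]nE'; apply: IH => //; first by lia.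
  by apply: rows_below_next => //; lia.
by apply: teqB; [apply: teqB; [apply: teqD|]|]; apply: next.
Qed.

(** The index [i] marks the moment at which the inner zero is deleted; before it the letters a_k,
    ..., a_(i-1) have been split off. *)
Lemma zword2_sum v k d : generic_position v -> (0 < k <= m)%N -> rows_below k d ->
  teq (zword 2 v k d)
      (\sum_(k <= i < m.+1)
         (-1) ^+ (i - k) *: rows_bsum (i - k) k (zword_turn v i) d).
Proof.
move=> gv; have [n nE] : exists n, (m - k = n)%N by exists (m - k)%N.
elim: n k d nE => [|n IH] k d nE kP dk.
  have kE : k = m by lia.
  rewrite {}kE in dk *; rewrite big_nat1 subnn rows_bsum0 expr0 scale1r.
  exact: zword2_last.
have k0 : (0 < k < m)%N by lia.
apply: teq_trans (zword2_step m_ge2 gv k0 dk) _.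
rewrite big_ltn; last by lia.
rewrite subnn rows_bsum0 expr0 scale1r; apply: teqD; first exact: teq_refl.
have next b c : teq (zword 2 v k.+1 (rcons d (entry k b, entry k c)))
    (\sum_(k.+1 <= i < m.+1) (-1) ^+ (i - k.+1) *:
      rows_bsum (i - k.+1) k.+1 (zword_turn v i) (rcons d (entry k b, entry k c))).
  by apply: IH; [lia | lia | apply: rows_below_next => //; lia].
apply: (teq_trans (t := \sum_(k.+1 <= i < m.+1) (
    (-1) ^+ (i - k.+1) *: rows_bsum (i - k.+1) k.+1 (zword_turn v i)
        (rcons d (entry k false, entry k true))
    + (-1) ^+ (i - k.+1) *: rows_bsum (i - k.+1) k.+1 (zword_turn v i)
        (rcons d (entry k true, entry k false))
    - (-1) ^+ (i - k.+1) *: rows_bsum (i - k.+1) k.+1 (zword_turn v i)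
        (rcons d (entry k true, entry k true))
    - (-1) ^+ (i - k.+1) *: rows_bsum (i - k.+1) k.+1 (zword_turn v i)
        (rcons d (entry k false, entry k false))))).
  rewrite !sumrB big_split /=.
  by apply: teqB; [apply: teqB; [apply: teqD|]|]; apply: next.
apply/teq_eq/eq_big_nat => i /andP[ki im].
rewrite (_ : i - k = (i - k.+1).+1)%N; last by lia.
exact/esym/rows_bsumS_sign.
Qed.

Lemma unzip_rows k b1 c1 b2 c2 e : size b1 = size c1 -> size b2 = size c2 ->
  let d := rcons (zip (entries 1 b1) (entries 1 c1)) (e, e)
           ++ zip (entries k b2) (entries k c2) in
  unzip1 d = entries 1 b1 ++ e :: entries k b2
  /\ unzip2 d = entries 1 c1 ++ e :: entries k c2.
Proof.
move=> s1 s2 d; rewrite /d /unzip1 /unzip2 !map_cat !map_rcons.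
rewrite -/unzip1 -/unzip2 ![unzip1 _]unzip1_zip ?[unzip2 _]unzip2_zip //;
  by rewrite ?size_entries ?s1 ?s2 ?cat_rcons.
Qed.

Lemma zword1_rows_sum v k (eps : bool) : generic_position v -> (0 < k <= m)%N ->
  teq (rows_bsum k.-1 1 (fun d => zword 1 v k (rcons d ((k.-1, eps), (k.-1, eps)))) [::])
      ((-1) ^+ k *: rows_sum m (col_word v) k eps).
Proof.
move=> gv kP; have m0 : (0 < m)%N by lia.
rewrite /rows_bsum /rows_sum -bsumZ; apply: teq_bsum => b1 szb1.
rewrite -bsumZ; apply: teq_bsum => c1 szc1.
set d := rcons _ _.
have dold : rows_below k d.
  apply: rows_below_turn; first by lia.
  apply/allP => -[e1 e2] /= ez.
  have e1P : e1.1 \in map fst (entries 1 b1).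
    apply: map_f; have := map_f fst ez.
    by rewrite -/(unzip1 _) unzip1_zip // !size_entries szb1 szc1.
  have e2P : e2.1 \in map fst (entries 1 c1).
    apply: map_f; have := map_f snd ez.
    by rewrite -/(unzip2 _) unzip2_zip // !size_entries szb1 szc1.
  have k1 : (1 + k.-1 = k)%N by lia.
  have /andP[_] := entries_bound e1P; rewrite szb1 k1 => ->.
  by have /andP[_] := entries_bound e2P; rewrite szc1 k1 => ->.
apply: teq_trans (zword1_sum gv kP dold) _; apply: teq_eq.
rewrite /rows_bsum -!bsumZ; apply: eq_bsum => b2 szb2.
rewrite -!bsumZ; apply: eq_bsum => c2 szc2.
have [E1 E2] := @unzip_rows k b1 c1 b2 c2 (k.-1, eps)
  (etrans szb1 (esym szc1)) (etrans szb2 (esym szc2)).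
have szd : size (d ++ zip (entries k b2) (entries k c2)) = m.
  rewrite size_cat size_rcons !size_zip !size_entries szb1 szc1 szb2 szc2 !minnn.
  by lia.
rewrite (Alt_row_word v m0 szd) /d E1 E2 scalerA -exprD.
(* The part m - k stems from the letters after the turn, the part m from [Alt_row_word]. *)
have -> : (-1) ^+ (m - k + m) = (-1) ^+ k :> rat; last by [].
by rewrite -[LHS]signr_odd -[RHS]signr_odd; congr (_ ^+ nat_of_bool _); lia.
Qed.

Lemma zword2_total v : generic_position v ->
  teq (zword 2 v 1 [::])
      (- ((2 * m * (2 * m - 1))%:R *: stair_word m (col_word v))).
Proof.
move=> gv; have m0 : (0 < m)%N by lia.
apply: teq_trans (zword2_sum gv _ _) _; [by [] | by [] |].
rewrite -(rows_sum_total m0 (col_word_alternating v)) -sumrN.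
apply: teq_sum_nat => i /andP[i0 im].
have iP : (0 < i <= m)%N by rewrite i0.
rewrite subn1.
apply: (teq_trans (t := (-1) ^+ i.-1 *: ((-1) ^+ i *: rows_sum m (col_word v) i false
                          - (-1) ^+ i *: rows_sum m (col_word v) i true))).
  apply: teqZ; apply: teq_trans (teqB (zword1_rows_sum false gv iP) (zword1_rows_sum true gv iP)).
  apply: teq_eq; rewrite /rows_bsum -bsumB; apply: eq_bsum => b _.
  by rewrite -bsumB.
apply: teq_eq; rewrite -scalerBr scalerA -exprD.
(* The i - 1 letters before the turn give (-1)^(i - 1) and the rest gives (-1)^i, so every term
   carries the same sign. *)
have -> : (-1) ^+ (i.-1 + i) = -1 :> rat; last by rewrite scaleN1r.
by rewrite -signr_odd (_ : odd _ = true) //; lia.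
Qed.

Lemma symbol_I_zrho w :
  symbol_I 0 (0 :: [seq rho w i | i <- iota 1 m.-1]) (rho w m)
  = symbol_rec m (zrho 2 w 1).
Proof.
have szm : size (0 :: [seq rho w i | i <- iota 1 m.-1]) = m.
  by rewrite /= size_map size_iota prednK; last by lia.
rewrite /symbol_I szm; apply: eq_symbol_rec => -[|[|i]] //; rewrite ltnS => im.
rewrite zrho_ge // [LHS]/= -map_rcons -cats1 -iota1_rcons; last by lia.
rewrite (nth_map 0%N) ?size_iota; last by lia.
by rewrite nth_iota; [congr rho|]; lia.
Qed.

Lemma Alt_symbol_I v : generic_position v ->
  teq (Alt (fun w => symbol_I 0 (0 :: [seq rho w i | i <- iota 1 m.-1]) (rho w m)) v)
      (- ((2 * m * (2 * m - 1))%:R *: stair_word m (col_word v))).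
Proof.
move=> gv; apply: teq_trans (zword2_total gv); apply/teq_eq/eq_Alt => w.
rewrite symbol_I_zrho /= (_ : m - 1 + 1 = m)%N; last by lia.
by rewrite /row_word big_nil mulr1.
Qed.

Lemma symbol_GrE v : generic_position v ->
  teq (symbol_Gr v) ((2 * m`!%:R ^+ 2) *: stair_word m (col_word v)).
Proof.
move=> gv; have m0 : (0 < m)%N by lia.
apply: (teq_trans (t := (2 * (-1) ^+ m * m`!%:R ^+ 2) *: ((-1) ^+ m *: stair_word m (col_word v)))).
  apply: teqZ; rewrite -Alt_minors //; apply: teq_Alt => s.
  rewrite !big_nat; apply: teq_prod => k kP.
  apply: letter_bracketE; first exact: generic_position_permt.
  - exact: iota_uniq.
  - exact: size_iota.
  by move=> j; rewrite mem_iota; lia.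
apply/teq_eq/scalerA_eq.
have ss : (-1) ^+ m * (-1) ^+ m = 1 :> rat by rewrite -expr2 sqrr_sign.
by move: ((-1) ^+ m) ss => s ss; ring: ss.
Qed.

(** Both sides are multiples of one [stair_word], and the constants agree: 2 m!^2 (2m - 1) / (m! (m
    - 1)!) = 2m(2m - 1). *)
Lemma Gr_symbol_I v : generic_position v ->
  teq (- ((2 * m - 1)%N%:R / (m`!%:R * (m.-1)`!%:R)) *: symbol_Gr v)
    (Alt (fun w => symbol_I 0 (0 :: [seq rho w i | i <- iota 1 m.-1]) (rho w m)) v).
Proof.
move=> gv; apply: teq_trans (teq_sym (Alt_symbol_I gv)).
apply: teq_trans (teqZ _ (symbol_GrE gv)) _; apply/teq_eq/scalerA_eqN.
have m0 : (0 < m)%N by lia.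
have f0 : (m.-1)`!%:R != 0 :> rat by rewrite Num.Theory.pnatr_eq0 -lt0n fact_gt0.
have mr0 : m%:R != 0 :> rat by rewrite Num.Theory.pnatr_eq0 -lt0n.
have -> : m`! = (m * (m.-1)`!)%N by rewrite -{1}(prednK m0) factS prednK.
rewrite !natrM; field.
by rewrite f0 mr0.
Qed.

End Assembly.

(** * General position of the generic tuple *)

Section Generic.

Variables (R : realType) (m : nat).

(** The minor is a polynomial that takes the value 1 when the chosen points are specialised to the
    standard basis vectors. *)
Lemma generic_position_generic : generic_position (generic R m).
Proof.
move=> s us sm.
pose M : 'M[mpoly (m * (2 * m)) R[i]]_m :=
  \matrix_(i, j) 'X_(mxvec_index i (tnth (tcast sm (in_tuple s)) j)).
have -> : bracket (generic R m) (pts s) = tofrac (\det M).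
  rewrite -det_map_mx /bracket; congr (\det _); apply/matrixP => i j.
  rewrite !mxE; set x := tnth _ j.
  have -> : (nth 0%N (pts s) j).-1 = val x.
    by rewrite (nth_map x) ?sm //= [in RHS]/x (tnth_nth x) val_tcast.
  by rewrite -(tnth_nth 0 (generic R m)) tnth_mktuple mxE.
rewrite tofrac_eq0.
pose P : 'M[R[i]]_(m, 2 * m) :=
  \matrix_(i, a) (tnth (tcast sm (in_tuple s)) i == a)%:R.
have : meval (fun x => mxvec P 0 x) (\det M) = 1.
  rewrite -det_map_mx -[RHS](det1 R[i] m); congr (\det _); apply/matrixP => i j.
  rewrite 2!mxE /= mevalXU mxvecE !mxE; congr (_%:R); congr nat_of_bool.
  have st : uniq (tcast sm (in_tuple s)) by rewrite val_tcast.
  by apply/eqP/eqP => [|->] //; move/tuple_uniqP: st; apply.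
by case: eqP => // ->; rewrite meval0 => /eqP; rewrite eq_sym oner_eq0.
Qed.

End Generic.

(** * Linearity of the symbol, and the theorem *)

Lemma in_alg_mull (A : lalgType rat) (c x : rat) (y : A) :
  in_alg A (c * x) * y = c *: (in_alg A x * y).
Proof. by rewrite /= -!scalerAl !mul1r scalerA. Qed.

Lemma symbolZ (K : fieldType) m (c : rat) (A : {malg rat[polylog K m]}) :
  symbol (c *: A) = c *: symbol A.
Proof.
rewrite /symbol (monalg.mmapEw (monalg.msuppZ_le _ _)) monalg.mmapE scaler_sumr.
apply: eq_bigr => k _; rewrite monalg.mcoeffZ; exact: in_alg_mull.
Qed.

Lemma symbolU (K : fieldType) m (x : polylog K m) :
  symbol (monalg.mkmalgU x 1) = symbol1 x.
Proof. by rewrite /symbol monalg.mmapU /= scale1r mul1r. Qed.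

Lemma symbol_Alt (K : fieldType) m
    (f : (2 * m).-tuple 'cV[K]_m -> {malg rat[polylog K m]}) v :
  symbol (Alt f v) = Alt (fun w => symbol (f w)) v.
Proof.
by rewrite /Alt /symbol raddf_sum; apply: eq_bigr => s _; apply: symbolZ.
Qed.

Theorem theorem3p2 (R : realType) (m : nat) (hm : (2 <= m)%N) :
  symbol_eq
    (- ((2 * m - 1)%N%:R / (m`!%:R * (m.-1)`!%:R)) *: Gr (generic R m))
    (Alt (fun v => II m 0 (0 :: [seq rho v i | i <- iota 1 m.-1]) (rho v m))
       (generic R m)).
Proof.
have gv := @generic_position_generic R m.
have := Gr_symbol_I hm gv; rewrite /symbol_eq /teq symbolZ symbolU symbol_Alt.
have -> : Alt (fun w => symbol
      (II m 0 (0 :: [seq rho w i | i <- iota 1 m.-1]) (rho w m))) (generic R m)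
    = Alt (fun w => symbol_I 0 (0 :: [seq rho w i | i <- iota 1 m.-1]) (rho w m))
        (generic R m).
  by apply: eq_Alt => w; rewrite symbolU.
by [].
Qed.
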